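(* A full order $\mathcal H$ of $\mathbb A=\mathbb M_2(K)$ is a Bass order if and only if its branch $\mathfrak s_K(\mathcal H)$ is a line, as a subgraph of the Bruhat–Tits tree $\mathfrak t(K)$.
   Context: $K$ is a non-archimedean local field with ring of integers $\mathcal O_K$ and uniformizer $\pi_K$; $\mathbb A=\mathbb M_2(K)$ with identity $\mathbf 1$. An order of $\mathbb A$ is a subring containing $\mathbf 1$ which is a finitely generated $\mathcal O_K$-submodule; it is full if it spans $\mathbb A$ over $K$. A full order $\mathcal R$ is Gorenstein if its codifferent $\{a\in\mathbb A:\mathrm{tr}(a\mathcal R)\subseteq\mathcal O_K\}$ is invertible as a two-sided fractional $\mathcal R$-ideal; a full order is Bass if every order containing it is Gorenstein. The Bruhat–Tits tree $\mathfrak t(K)$ is the graph whose vertices are the maximal orders of $\mathbb A$, two of them being adjacent iff in some basis of $K^2$ they equal $\mathbb M_2(\mathcal O_K)$ and $\begin{pmatrix}\mathcal O_K&\pi_K^{-1}\mathcal O_K\\ \pi_K\mathcal O_K&\mathcal O_K\end{pmatrix}$ respectively. The branch $\mathfrak s_K(\mathcal H)$ is the induced subgraph of $\mathfrak t(K)$ whose vertices are the maximal orders containing $\mathcal H$. A line is a subgraph isomorphic to a connected subgraph of the graph with vertex set $\mathbb Z$ and edges joining consecutive integers (in particular a single vertex is a line). *)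

(* Defs.v *)
From HB Require Import structures.
From mathcomp Require Import all_boot all_order all_algebra.
Set Implicit Arguments. Unset Strict Implicit. Unset Printing Implicit Defensive.
Import Order.TTheory GRing.Theory Num.Theory.
Local Open Scope ring_scope.

(* A non-archimedean local field is modelled as a field K
   together with a normalized discrete valuation v : K -> int (the value v 0
   is irrelevant and never used), such that K is complete for v and the
   residue field O_K / pi O_K is finite. *)

Section LocalField.
Variable K : fieldType.
Variable v : K -> int.

Definition intO (x : K) : Prop := x = 0 \/ 0 <= v x.
Definition val_ge (N : int) (x : K) : Prop := x = 0 \/ N <= v x.

Definition is_local_field : Prop :=
  [/\ (forall x y : K, x != 0 -> y != 0 -> v (x * y) = v x + v y),
      (forall x y : K, x != 0 -> y != 0 -> x + y != 0 ->
          Num.min (v x) (v y) <= v (x + y)),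
      (exists pi : K, pi != 0 /\ v pi = 1),
      (forall u : nat -> K,
          (forall N : int, exists n0 : nat, forall m n : nat,
              (n0 <= m)%N -> (n0 <= n)%N -> val_ge N (u m - u n)) ->
          exists l : K, forall N : int, exists n0 : nat, forall n : nat,
              (n0 <= n)%N -> val_ge N (u n - l))
    &
      (exists s : seq K, forall x, intO x ->
          exists2 r, r \in s & val_ge 1 (x - r))].

Definition mx := 'M[K]_2.
Definition mxset := mx -> Prop.

Definition subsetM (A B : mxset) : Prop := forall a, A a -> B a.
Definition samesetM (A B : mxset) : Prop := forall a, A a <-> B a.

Definition Ospan (s : seq mx) : mxset :=
  fun a => exists c : nat -> K, (forall i, intO (c i)) /\
             a = \sum_(i < size s) c i *: s`_i.

Definition fg_Omodule (H : mxset) : Prop :=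
  exists s : seq mx, forall a, H a <-> Ospan s a.

Definition Kspans (H : mxset) : Prop :=
  forall a : mx, exists s : seq mx, exists c : nat -> K,
    (forall x, x \in s -> H x) /\ a = \sum_(i < size s) c i *: s`_i.

Definition is_order (H : mxset) : Prop :=
  [/\ H 1, (forall a b, H a -> H b -> H (a + b)), (forall a, H a -> H (- a)),
      (forall a b, H a -> H b -> H (a * b)) & fg_Omodule H].

Definition is_full_order (H : mxset) : Prop := is_order H /\ Kspans H.

Definition is_lattice (I : mxset) : Prop := fg_Omodule I /\ Kspans I.

Definition codifferent (H : mxset) : mxset :=
  fun a => forall r, H r -> intO (\tr (a * r)).

Definition prodset (I J : mxset) : mxset :=
  fun z => exists s : seq (mx * mx),
    (forall p, p \in s -> I p.1 /\ J p.2) /\ z = \sum_(p <- s) p.1 * p.2.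

Definition two_sided_frac_ideal (H I : mxset) : Prop :=
  [/\ is_lattice I, (forall h x, H h -> I x -> I (h * x))
    & (forall h x, H h -> I x -> I (x * h))].

Definition invertible_two_sided (H I : mxset) : Prop :=
  two_sided_frac_ideal H I /\
  exists J : mxset, two_sided_frac_ideal H J /\
    samesetM (prodset I J) H /\ samesetM (prodset J I) H.

Definition Gorenstein (H : mxset) : Prop :=
  is_full_order H /\ invertible_two_sided H (codifferent H).

Definition Bass (H : mxset) : Prop :=
  is_full_order H /\
  forall R, is_order R -> subsetM H R -> Gorenstein R.

Definition maximal_order (R : mxset) : Prop :=
  is_order R /\ forall R', is_order R' -> subsetM R R' -> subsetM R' R.

Definition conj_set (g : mx) (S : mxset) : mxset :=
  fun a => exists2 x, S x & a = g * x * invmx g.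

Definition M2O : mxset := fun x => forall i j, intO (x i j).

Definition Eichler_std (pi : K) : mxset := fun x =>
  [/\ intO (x ord0 ord0), intO (x ord_max ord_max),
      intO (pi * x ord0 ord_max) & intO (pi^-1 * x ord_max ord0)].

Definition BT_adjacent (pi : K) (R1 R2 : mxset) : Prop :=
  exists g : mx, g \in unitmx /\
    samesetM R1 (conj_set g M2O) /\ samesetM R2 (conj_set g (Eichler_std pi)).

Definition branch (H : mxset) : mxset -> Prop :=
  fun R => maximal_order R /\ subsetM H R.

(* The induced subgraph of the tree on vertex set S is a line: it is
   isomorphic to the path graph on a nonempty interval of Z. *)
Definition is_line (pi : K) (S : mxset -> Prop) : Prop :=
  exists (I : int -> Prop) (f : int -> mxset),
  [/\ (exists i, I i),
      (forall a b c, I a -> I b -> a <= c -> c <= b -> I c),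
      (forall i, I i -> S (f i)) /\
      (forall R, S R -> exists i, I i /\ samesetM (f i) R),
      (forall i j, I i -> I j -> samesetM (f i) (f j) -> i = j)
    & (forall i j, I i -> I j -> (BT_adjacent pi (f i) (f j) <-> `|i - j| = 1))].

End LocalField.

(* Main.v *)
Require Import Defs.
From mathcomp Require Import all_boot all_order all_algebra.
From mathcomp Require Import ring zify.
From Stdlib Require Import Classical_Prop.
Set Implicit Arguments. Unset Strict Implicit. Unset Printing Implicit Defensive.
Import Order.TTheory GRing.Theory Num.Theory.
Local Open Scope ring_scope.

(* Let [O] be the valuation ring, and for a full order [R] write
   [R = O + O e1 + O e2 + O e3].  The traceless part of the codifferent of [R] is spanned by
   [d1 = [e2, e3] / D], [d2 = [e3, e1] / D], [d3 = [e1, e2] / D] with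
   [D = tr (e1 [e2, e3])], the ternary form [q x = D * det x] is integral on it, and
   [R] is the even Clifford algebra of [q].  If [q] takes a unit value at [x], then
   [x] generates the codifferent and [R] is Gorenstein.  Otherwise [q / pi] is integral
   and its even Clifford algebra [R'] is an order with [R] inside [O + pi R'];
   putting [R'] in a maximal order [M] gives [R] inside [O + pi M], so that [M] and all
   its neighbours (at least three) lie in the branch, which is not a line.
   Conversely [O + pi M] is never Gorenstein, so no such [M] exists for a Bass order
   [H].  Take a path of maximal length among those whose ends are in the branch
   of [H]: a vertex of the branch outside it leaves it either at an end,
   contradicting maximality, or at an inner vertex [M], in which case [H] is inside
   [O + pi M]. *)

(** * Two by two matrices *)

Section Matrices.
Variable K : fieldType.
Implicit Types (a b c d k : K) (x y z e A : 'M[K]_2).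

Definition mk a b c d : 'M[K]_2 :=
  \matrix_(i, j) if i == 0 then (if j == 0 then a else b)
                 else (if j == 0 then c else d).

Lemma ord2P (P : 'I_2 -> Prop) : P ord0 -> P ord_max -> forall i, P i.
Proof.
move=> P0 P1 i; case: (unliftP ord0 i) => [j ->|->] //.
by rewrite (ord1 j) (_ : lift _ _ = ord_max) //; apply: val_inj.
Qed.

Lemma mk00 a b c d : mk a b c d ord0 ord0 = a. Proof. by rewrite mxE. Qed.
Lemma mk01 a b c d : mk a b c d ord0 ord_max = b. Proof. by rewrite mxE. Qed.
Lemma mk10 a b c d : mk a b c d ord_max ord0 = c. Proof. by rewrite mxE. Qed.
Lemma mk11 a b c d : mk a b c d ord_max ord_max = d. Proof. by rewrite mxE. Qed.
Definition mkE := (mk00, mk01, mk10, mk11).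

Lemma mxP2 x y :
  x ord0 ord0 = y ord0 ord0 -> x ord0 ord_max = y ord0 ord_max ->
  x ord_max ord0 = y ord_max ord0 -> x ord_max ord_max = y ord_max ord_max ->
  x = y.
Proof. by move=> *; apply/matrixP; apply: ord2P; apply: ord2P. Qed.

Lemma mkP x : exists a b c d, x = mk a b c d.
Proof.
exists (x ord0 ord0), (x ord0 ord_max), (x ord_max ord0), (x ord_max ord_max).
by apply: mxP2; rewrite mkE.
Qed.

Lemma sum2 (V : nmodType) (F : 'I_2 -> V) : \sum_i F i = F ord0 + F ord_max.
Proof.
by rewrite big_ord_recl big_ord1; congr (_ + F _); apply: val_inj.
Qed.

Lemma mkM a b c d a' b' c' d' : mk a b c d * mk a' b' c' d' =
  mk (a * a' + b * c') (a * b' + b * d') (c * a' + d * c') (c * b' + d * d').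
Proof. by apply: mxP2; rewrite !mxE sum2 !mkE. Qed.
Lemma mkD a b c d a' b' c' d' : mk a b c d + mk a' b' c' d' =
  mk (a + a') (b + b') (c + c') (d + d').
Proof. by apply: mxP2; rewrite !mxE. Qed.
Lemma mkN a b c d : - mk a b c d = mk (- a) (- b) (- c) (- d).
Proof. by apply: mxP2; rewrite !mxE. Qed.
Lemma mkZ k a b c d : k *: mk a b c d = mk (k * a) (k * b) (k * c) (k * d).
Proof. by apply: mxP2; rewrite !mxE. Qed.
Lemma mk1 : 1 = mk 1 0 0 1.
Proof. by apply: mxP2; rewrite !mxE. Qed.
Lemma mk0 : 0 = mk 0 0 0 0.
Proof. by apply: mxP2; rewrite !mxE. Qed.
Lemma mktr a b c d : \tr (mk a b c d) = a + d.
Proof. by rewrite /mxtrace sum2 !mkE. Qed.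
Lemma mkdet a b c d : \det (mk a b c d) = a * d - b * c.
Proof.
rewrite (expand_det_row _ ord0) sum2 /cofactor !mkE /= !det_mx11 !mxE /=.
by rewrite addn0 expr0 mul1r addn1 expr1; ring.
Qed.

Definition mkEs := (mkN, mkM, mkD, mkZ, mk1, mk0, mktr, mkdet).

End Matrices.

Ltac mx2_split x := have [? [? [? [? ->]]]] := mkP x.
Ltac mx2_ring := rewrite ?mkEs; try (congr mk); ring.

(** * Identities for commutators and traceless matrices *)

Section Identities.
Variable K : fieldType.
Implicit Types (k : K) (x y z e : 'M[K]_2).

Definition comm x y := x * y - y * x.
(** An alternating trilinear form that vanishes as soon as one argument is scalar: a volume form on
    the three-dimensional space $\mathbb M_2(K)/K$. *)
Definition trip x y z := \tr (x * comm y z).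

Lemma tripC x y z : trip x y z = trip y z x.
Proof. by rewrite /trip /comm; mx2_split x; mx2_split y; mx2_split z; mx2_ring. Qed.

Lemma cayley x : x * x = \tr x *: x - \det x *: 1.
Proof. mx2_split x; mx2_ring. Qed.

Lemma det_add x y :
  \det (x + y) = \det x + \det y + (\tr x * \tr y - \tr (x * y)).
Proof. mx2_split x; mx2_split y; mx2_ring. Qed.

Lemma det_comm x y : \det (comm x y) = - \tr (comm x y * x * y).
Proof. by rewrite /comm; mx2_split x; mx2_split y; mx2_ring. Qed.

(** Analogue of the vector identity for a cross product of two cross products; it recovers [x], up
    to a scalar matrix, from commutators alone. *)
Lemma comm_mul_comm x y z :
  comm z x * comm x y = \tr (comm z x * x * y) *: 1 - trip x y z *: x.
Proof. by rewrite /trip /comm; mx2_split x; mx2_split y; mx2_split z; mx2_ring. Qed.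

(** Cramer's rule for the volume form on $\mathbb M_2(K)/K$: the two sides agree modulo scalar
    matrices, so [k] can be read off a diagonal entry of their difference. *)
Lemma trip_expand (e1 e2 e3 y : 'M[K]_2) : exists k : K,
  trip e1 e2 e3 *: y = k *: 1 + trip y e2 e3 *: e1 + trip y e3 e1 *: e2
                       + trip y e1 e2 *: e3.
Proof.
exists ((trip e1 e2 e3 *: y - (trip y e2 e3 *: e1 + trip y e3 e1 *: e2
                       + trip y e1 e2 *: e3)) ord0 ord0).
rewrite /trip /comm.
mx2_split e1; mx2_split e2; mx2_split e3; mx2_split y.
rewrite !mkEs !mkE; congr mk; ring.
Qed.

(** Cramer's rule on the dual side: a traceless matrix is recovered from its trace pairings with
    [e1], [e2], [e3]. *)
Lemma trip_expand0 (e1 e2 e3 y : 'M[K]_2) : \tr y = 0 ->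
  trip e1 e2 e3 *: y = \tr (y * e1) *: comm e2 e3 + \tr (y * e2) *: comm e3 e1
                       + \tr (y * e3) *: comm e1 e2.
Proof.
have [a [b [c [d ->]]]] := mkP y; rewrite mktr => /eqP; rewrite addr_eq0 => /eqP ->.
rewrite /trip /comm.
mx2_split e1; mx2_split e2; mx2_split e3; mx2_ring.
Qed.

Lemma traceless_anticomm x y : \tr x = 0 -> \tr y = 0 ->
  x * y + y * x = \tr (x * y) *: 1.
Proof.
have [a [b [c [d ->]]]] := mkP x; have [a' [b' [c' [d' ->]]]] := mkP y.
rewrite !mktr => /eqP; rewrite addr_eq0 => /eqP -> /eqP; rewrite addr_eq0 => /eqP ->.
mx2_ring.
Qed.

Lemma traceless_sq x : \tr x = 0 -> x * x = (- \det x) *: 1.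
Proof. by move=> tx; rewrite cayley tx scale0r sub0r scaleNr. Qed.

(** This and the next two identities give, up to cyclic rotation, the multiplication table of
    [y * z], [z * x], [x * y]. Generators come with coefficients linear in the values of [\det] and
    its polar form, the identity with quadratic ones; hence rescaling generators by [l] amounts to
    replacing [\det] by [l * \det]. *)
Lemma clifford_diag y z :
  (y * z) * (y * z) = \tr (y * z) *: (y * z) - (\det y * \det z) *: 1.
Proof. by rewrite cayley; congr (_ - _ *: _); rewrite det_mulmx. Qed.

Lemma clifford_next x y z : \tr x = 0 -> \tr y = 0 -> \tr z = 0 ->
  (y * z) * (z * x) = (\det z) *: (x * y) - (\det z * \tr (x * y)) *: 1.
Proof.
move=> tx ty tz; rewrite -mulrA [z * _]mulrA (traceless_sq tz).
rewrite -scalerAl mul1r -scalerAr scaleNr -scalerA -(traceless_anticomm tx ty).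
by rewrite scalerDr opprD addrA subrr add0r.
Qed.

Lemma clifford_prev x y z : \tr x = 0 -> \tr y = 0 -> \tr z = 0 ->
  (z * x) * (y * z) = \tr (y * z) *: (z * x) - (\tr (z * x) * \tr (y * z)) *: 1
     + \tr (z * x) *: (y * z) - \det z *: (x * y).
Proof.
move=> tx ty tz; move: ty tz tx.
have [a [b [c [d ->]]]] := mkP x; have [a' [b' [c' [d' ->]]]] := mkP y.
have [e [f [g [h ->]]]] := mkP z.
rewrite !mktr => /eqP; rewrite addr_eq0 => /eqP -> /eqP; rewrite addr_eq0 => /eqP ->.
move=> /eqP; rewrite addr_eq0 => /eqP ->.
mx2_ring.
Qed.

End Identities.

(** * Dual vectors for the trace form *)

Section Dual.
Variable K : fieldType.
Implicit Types (k : K) (x y z e : 'M[K]_2).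

(** For nonzero [trip x y z], this is the matrix whose trace pairing is 1 with [x] and 0 with [1],
    [y] and [z]. *)
Definition dual x y z := (trip x y z)^-1 *: comm y z.

Lemma tr_comm x y : \tr (comm x y) = 0.
Proof. by rewrite /comm raddfB /= [\tr (y * x)]mxtrace_mulC subrr. Qed.
Lemma tr_dual x y z : \tr (dual x y z) = 0.
Proof. by rewrite /dual mxtraceZ tr_comm mulr0. Qed.
Lemma tr_mul_dual t x y z : \tr (t * dual x y z) = trip t y z / trip x y z.
Proof. by rewrite /dual -scalerAr mxtraceZ mulrC. Qed.
Lemma tr_mul_dual_self x y z : trip x y z != 0 -> \tr (x * dual x y z) = 1.
Proof. by move=> ne; rewrite tr_mul_dual divff. Qed.
Lemma tr_mul_dual_prev x y z : \tr (z * dual x y z) = 0.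
Proof.
rewrite tr_mul_dual (_ : trip z y z = 0) ?mul0r //.
by rewrite /trip /comm; mx2_split y; mx2_split z; mx2_ring.
Qed.

Lemma scale_dual x y z : trip x y z != 0 -> trip x y z *: dual x y z = comm y z.
Proof. by move=> ne; rewrite /dual scalerA divff // scale1r. Qed.

(** Read backwards, [x] is a scalar minus a multiple of a product of two dual vectors: this is what
    exhibits an order as an even Clifford algebra. *)
Lemma dual_mul_dual x y z : trip x y z != 0 ->
  trip x y z *: (dual y z x * dual z x y) = \tr (dual y z x * x * y) *: 1 - x.
Proof.
rewrite /dual -(tripC x y z) (tripC z x y); set D := trip x y z => ne.
rewrite -!scalerAl -scalerAr mxtraceZ comm_mul_comm -/D !scalerA divff // mul1r.
by rewrite scalerBr !scalerA mulVf // scale1r.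
Qed.

(** The value of the ternary form at a dual vector becomes a trace pairing of that vector with
    [y * z], hence integral when the vector is in the codifferent of an order containing [y] and
    [z]. *)
Lemma det_dual x y z : trip x y z != 0 ->
  trip x y z * \det (dual x y z) = - \tr (dual x y z * y * z).
Proof.
rewrite /dual; set D := trip x y z => ne.
rewrite detZ det_comm -!scalerAl mxtraceZ expr2 !mulrA divff // mul1r.
by rewrite mulrN.
Qed.

Lemma dual_expand (x y z t : 'M[K]_2) : trip x y z != 0 -> \tr t = 0 ->
  t = \tr (t * x) *: dual x y z + \tr (t * y) *: dual y z x + \tr (t * z) *: dual z x y.
Proof.
move=> ne t0; rewrite /dual -(tripC x y z) (tripC z x y).
move: ne (trip_expand0 x y z t0); set D := trip x y z => ne E.
apply: (scalerI ne); rewrite E !scalerDr.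
by congr (_ + _ + _); rewrite !scalerA mulrAC divff // mul1r.
Qed.

End Dual.
(** * Valuation and orders *)

Lemma ex_min_nat (P : nat -> Prop) :
  (exists n, P n) -> exists n, P n /\ forall m, P m -> (n <= m)%N.
Proof.
move=> [n Pn]; apply: NNPP => nmin.
have: forall m, ~ P m.
  elim/ltn_ind => m IH Pm; apply: nmin; exists m; split=> // p Pp.
  by rewrite leqNgt; apply/negP => /IH.
by move/(_ n).
Qed.

Section Valued.
Variables (K : fieldType) (v : K -> int) (hK : is_local_field v).
Variables (pi : K) (pi0 : pi != 0) (vpi : v pi = 1).
Implicit Types (k l u : K) (x y z e g : 'M[K]_2) (N : int) (R S : mxset K).

Lemma vM k l : k != 0 -> l != 0 -> v (k * l) = v k + v l.
Proof. by case: hK => + _ _ _ _; apply. Qed.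

Lemma v1 : v 1 = 0.
Proof.
have := @vM 1 1 (oner_neq0 _) (oner_neq0 _).
by rewrite mulr1 => /(congr1 (fun t => t - v 1)); rewrite addrK subrr.
Qed.

Lemma vN k : v (- k) = v k.
Proof.
have [->|k0] := eqVneq k 0; first by rewrite oppr0.
have m1 : (- 1 : K) != 0 by rewrite oppr_eq0 oner_neq0.
have := vM m1 m1; rewrite mulrNN mulr1 v1 => h.
by rewrite -mulN1r vM //; lia.
Qed.

Lemma vV k : k != 0 -> v k^-1 = - v k.
Proof.
move=> k0; have := @vM k k^-1 k0; rewrite invr_eq0 divff // v1 => /(_ k0); lia.
Qed.

Lemma vXz (i : int) : v (pi ^ i) = i.
Proof.
have vn (n : nat) : v (pi ^+ n) = n%:Z.
  elim: n => [|n IH]; first by rewrite expr0 v1.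
  by rewrite exprS vM ?expf_neq0 // IH vpi; lia.
case: i => n; first exact: vn.
by rewrite NegzE -exprnN vV ?expf_neq0 // vn.
Qed.

Lemma piz0 (i : int) : pi ^ i != 0. Proof. exact: expfz_neq0. Qed.

Notation vge := (val_ge v).

Lemma vge_le N M k : N <= M -> vge M k -> vge N k.
Proof. by move=> NM [->|h]; [left|right; apply: le_trans h]. Qed.
Lemma vge0 N : vge N 0. Proof. by left. Qed.
Lemma vge_v k : vge (v k) k. Proof. by right. Qed.
Lemma vgeN N k : vge N k -> vge N (- k).
Proof. by move=> [->|h]; [left; rewrite oppr0|right; rewrite vN]. Qed.
Lemma vgeD N k l : vge N k -> vge N l -> vge N (k + l).
Proof.
have [->|k0] := eqVneq k 0; first by rewrite add0r.
have [->|l0] := eqVneq l 0; first by rewrite addr0.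
move=> [/eqP|hk]; first by rewrite (negPf k0).
move=> [/eqP|hl]; first by rewrite (negPf l0).
have [->|kl0] := eqVneq (k + l) 0; first by left.
right; case: hK => _ /(_ k l k0 l0 kl0) h _ _ _; apply: le_trans h.
by rewrite le_min hk.
Qed.
Lemma vgeB N k l : vge N k -> vge N l -> vge N (k - l).
Proof. by move=> hk hl; apply/vgeD/vgeN. Qed.
Lemma vgeM N M k l : vge N k -> vge M l -> vge (N + M) (k * l).
Proof.
have [->|k0] := eqVneq k 0; first by rewrite mul0r; left.
have [->|l0] := eqVneq l 0; first by rewrite mulr0; left.
move=> [/eqP|hk]; first by rewrite (negPf k0).
move=> [/eqP|hl]; first by rewrite (negPf l0).
by right; rewrite vM // lerD.
Qed.
Lemma vge_pi N : vge N (pi ^ N). Proof. by right; rewrite vXz. Qed.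
Lemma vge_inv N k : vge N k -> k != 0 -> N <= v k.
Proof. by move=> [->|//]; rewrite eqxx. Qed.
Lemma vge_sum N (I : finType) (F : I -> K) :
  (forall i, vge N (F i)) -> vge N (\sum_i F i).
Proof. by move=> h; elim/big_ind: _ => //; [apply: vge0|apply: vgeD]. Qed.

Notation iO := (intO v).
Lemma iO0 : iO 0. Proof. by left. Qed.
Lemma iO1 : iO 1. Proof. by right; rewrite v1. Qed.
Lemma iOD k l : iO k -> iO l -> iO (k + l). Proof. exact: vgeD. Qed.
Lemma iOB k l : iO k -> iO l -> iO (k - l). Proof. exact: vgeB. Qed.
Lemma iON k : iO k -> iO (- k). Proof. exact: vgeN. Qed.
Lemma iOM k l : iO k -> iO l -> iO (k * l).
Proof. by move=> hk hl; have := @vgeM 0 0 k l hk hl; rewrite addr0. Qed.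
Lemma iO_pi : iO pi. Proof. by right; rewrite vpi. Qed.
Lemma iO_piz (i : int) : 0 <= i -> iO (pi ^ i).
Proof. by right; rewrite vXz. Qed.
Lemma iO_div k l : l != 0 -> vge (v l) k -> iO (k / l).
Proof.
move=> l0 hk; have := vgeM hk (vge_v l^-1).
by rewrite vV // subrr.
Qed.
Lemma iO_sq k : iO (k * k) -> iO k.
Proof.
have [->|k0] := eqVneq k 0; first by left.
by move/vge_inv => /(_ (mulf_neq0 k0 k0)); rewrite vM // => h; right; lia.
Qed.
Lemma vge1_pi k : vge 1 k -> iO (k / pi).
Proof. by move=> h; apply: iO_div => //; rewrite vpi. Qed.
Lemma vge1_1 : ~ vge 1 1.
Proof. by move/vge_inv => /(_ (oner_neq0 _)); rewrite v1. Qed.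
Lemma iO_unitP k : iO k -> (k != 0 /\ v k = 0) \/ vge 1 k.
Proof.
have [->|k0] := eqVneq k 0; first by right; left.
move/vge_inv => /(_ k0); rewrite le_eqVlt => /orP [/eqP <-|h]; first by left.
by right; right; lia.
Qed.

(** Values are integers bounded below by [N], so subtracting [N] reduces to a minimum of natural
    numbers. Minimality is stated as integrality of quotients because these will be coordinates
    given by Cramer's rule. *)
Lemma ex_min_val (T : Type) (S : T -> Prop) (f : T -> K) N :
  (exists t, S t /\ f t != 0) -> (forall t, S t -> vge N (f t)) ->
  exists t, [/\ S t, f t != 0 & forall t', S t' -> iO (f t' / f t)].
Proof.
move=> [t0 [St0 ft0]] bd.
have [|n [[t [St ft hn]] minn]] := @ex_min_nat
    (fun n => exists t, [/\ S t, f t != 0 & v (f t) - N = n%:Z]).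
  exists `|v (f t0) - N|%N, t0; split=> //.
  by have := vge_inv (bd _ St0) ft0; lia.
exists t; split=> // t' St'; apply: iO_div => //.
have [->|ft'] := eqVneq (f t') 0; first exact: vge0.
have ge := vge_inv (bd _ St') ft'.
have := minn `|v (f t') - N|%N; right.
have : (n <= `|v (f t') - N|)%N by apply: minn; exists t'; split=> //; lia.
lia.
Qed.

Lemma seq_bounded (s : seq 'M[K]_2) :
  exists M : int, forall x, x \in s -> forall i j, vge M (x i j).
Proof.
elim: s => [|x s [M hM]]; first by exists 0.
pose M' := Num.min (Num.min (v (x ord0 ord0)) (v (x ord0 ord_max)))
                   (Num.min (v (x ord_max ord0)) (v (x ord_max ord_max))).
exists (Num.min M M') => y; rewrite inE => /orP [/eqP ->|ys].
  suff h i j : vge M' (x i j).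
    by move=> i j; apply: vge_le (h i j); rewrite ge_min lexx orbT.
  by move: i j; apply: ord2P; apply: ord2P;
     apply: vge_le (vge_v _); rewrite !ge_min ?lexx ?orbT.
by move=> i j; apply: vge_le (hM y ys i j); rewrite ge_min lexx.
Qed.

Lemma fg_bounded S : fg_Omodule v S ->
  exists N, forall x, S x -> forall i j, vge N (x i j).
Proof.
move=> [s hs]; have [M hM] := seq_bounded s.
exists M => x /hs [c [cO ->]] i j; rewrite summxE; apply: vge_sum => k.
rewrite mxE -[M]add0r; apply: vgeM; first exact: cO.
by apply: hM; rewrite mem_nth.
Qed.

Lemma fg_scale S k x : fg_Omodule v S -> iO k -> S x -> S (k *: x).
Proof.
move=> [s hs] kO /hs [c [cO ->]]; apply/hs.
exists (fun i => k * c i); split=> [i|]; first exact: iOM.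
by rewrite scaler_sumr; apply: eq_bigr => i _; rewrite scalerA.
Qed.

Section Order.
Variables (R : mxset K) (hR : is_order v R).

Lemma order1 : R 1. Proof. by case: hR. Qed.
Lemma orderD x y : R x -> R y -> R (x + y).
Proof. by case: hR => _ + _ _ _; apply. Qed.
Lemma orderN x : R x -> R (- x). Proof. by case: hR => _ _ + _ _; apply. Qed.
Lemma orderB x y : R x -> R y -> R (x - y).
Proof. by move=> hx hy; apply/orderD/orderN. Qed.
Lemma orderM x y : R x -> R y -> R (x * y).
Proof. by case: hR => _ _ _ + _; apply. Qed.
Lemma orderZ k x : iO k -> R x -> R (k *: x).
Proof. by move=> kO; apply: fg_scale kO; case: hR. Qed.
Lemma order_scalar k : iO k -> R (k *: 1).
Proof. by move=> kO; apply: orderZ => //; apply: order1. Qed.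

(** The powers of [x] stay in [R], whose entries have bounded denominators, while a negative
    valuation of [\det x] would make the valuations of its powers tend to minus infinity. *)
Lemma order_det x : R x -> iO (\det x).
Proof.
move=> Rx; have [N hN] : exists N, forall x, R x -> forall i j, vge N (x i j).
  by apply: fg_bounded; case: hR.
have RX (n : nat) : R (x ^+ n).
  by elim: n => [|n IH]; rewrite ?expr0 ?exprS; [exact: order1|exact: orderM].
have detX (n : nat) : \det (x ^+ n) = \det x ^+ n.
  elim: n => [|n IH]; rewrite ?expr0 ?det1 // !exprS -IH; exact: det_mulmx.
have bd (n : nat) : vge (N + N) (\det x ^+ n).
  rewrite -detX; have := hN _ (RX n).
  have [a [b [c [d ->]]]] := mkP (x ^+ n) => h; rewrite mkdet.
  by have := (h ord0 ord0, h ord0 ord_max, (h ord_max ord0, h ord_max ord_max));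
    rewrite !mkE => -[[? ?] [? ?]]; apply: vgeB; apply: vgeM.
have [->|dx0] := eqVneq (\det x) 0; first by left.
right; rewrite leNgt; apply/negP => neg.
have vX (n : nat) : v (\det x ^+ n) = v (\det x) * n%:Z.
  elim: n => [|n IH]; first by rewrite expr0 v1 mulr0.
  by rewrite exprS vM ?expf_neq0 // IH; lia.
(* If [v (\det x)] is at most -1, this power has valuation at most $-2|N|-1$, which is below
   $2N$. *)
have := vge_inv (bd (`|N| + `|N|).+1) (expf_neq0 _ dx0).
rewrite vX; nia.
Qed.

Lemma order_tr x : R x -> iO (\tr x).
Proof.
move=> Rx; have -> : \tr x = \det (x + 1) - \det x - 1.
  by mx2_split x; rewrite !mkEs; ring.
apply: iOB iO1; apply: iOB; apply: order_det => //.
by apply: orderD => //; apply: order1.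
Qed.

Lemma order_scalar_inv k : R (k *: 1) -> iO k.
Proof.
move/order_det; rewrite mk1 mkZ mkdet => h; apply: iO_sq.
by move: h; rewrite !mulr1 !mulr0 subr0.
Qed.

End Order.

Lemma Kspans_ind S (P : 'M[K]_2 -> Prop) : Kspans S ->
  P 0 -> (forall x y, P x -> P y -> P (x + y)) -> (forall k x, P x -> P (k *: x)) ->
  (forall x, S x -> P x) -> forall x, P x.
Proof.
move=> hS P0 PD PZ SP x; have [s [c [sS ->]]] := hS x.
elim/big_ind: _ => // i _; apply/PZ/SP/sS; exact: mem_nth.
Qed.

Lemma tripD x x' y z : trip (x + x') y z = trip x y z + trip x' y z.
Proof. by rewrite /trip mulrDl mxtraceD. Qed.
Lemma tripZ k x y z : trip (k *: x) y z = k * trip x y z.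
Proof. by rewrite /trip -scalerAl mxtraceZ. Qed.
Lemma trip0 y z : trip 0 y z = 0 :> K.
Proof. by rewrite /trip mul0r mxtrace0. Qed.

Lemma Kspans_trip R : Kspans R ->
  exists e1 e2 e3, [/\ R e1, R e2, R e3 & trip e1 e2 e3 != 0].
Proof.
move=> hR; apply: NNPP => none.
have h0 x y z : R x -> R y -> R z -> trip x y z = 0.
  move=> Rx Ry Rz; apply/eqP; apply: contraT => ne; case: none.
  by exists x, y, z.
(* Linearity frees the first argument from [R]; cyclicity of [trip] then brings the other two to
   that place in turn. *)
have ext (P : 'M[K]_2 -> 'M[K]_2 -> Prop) :
  (forall x y z, R x -> P y z -> trip x y z = 0) -> forall x y z, P y z -> trip x y z = 0.
  move=> h x y z Pyz; apply: (Kspans_ind (P := fun x => trip x y z = 0) hR)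
    => [|x1 x2|k x1|x1 Rx].
  - exact: trip0.
  - by rewrite tripD => -> ->; rewrite addr0.
  - by rewrite tripZ => ->; rewrite mulr0.
  - exact: h.
have h1 : forall x y z, R y /\ R z -> trip x y z = 0.
  by apply: ext => x y z Rx [Ry Rz]; apply: h0.
have h2 : forall x y z, R y -> trip x y z = 0.
  apply: (ext (fun y z => R y)) => x y z Rx Ry.
  by rewrite tripC tripC; apply: h1.
have h3 : forall x y z, True -> trip x y z = 0.
  by apply: ext => x y z Rx _; rewrite tripC tripC; apply: h2.
have := h3 (mk 1 0 0 0) (mk 0 1 0 0) (mk 0 0 1 0) I.
rewrite /trip /comm !mkEs !(mulr0, mul0r, mulr1, addr0, add0r, subr0, oppr0).
by move/eqP; rewrite oner_eq0.
Qed.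

(** A triple in [R] with [trip] of least valuation works: substituting [y] for one member cannot
    lower the valuation, and the resulting quotients are the coordinates of [y]. *)
Lemma full_order_basis R : is_full_order v R ->
  exists e1 e2 e3, [/\ R e1, R e2 & R e3] /\ [/\ trip e1 e2 e3 != 0,
    forall y, R y -> iO (trip y e2 e3 / trip e1 e2 e3),
    forall y, R y -> iO (trip y e3 e1 / trip e1 e2 e3)
  & forall y, R y -> iO (trip y e1 e2 / trip e1 e2 e3)].
Proof.
move=> [hR sR]; have [e1 [e2 [e3 [R1 R2 R3 ne]]]] := Kspans_trip sR.
have [||[[f1 f2] f3] [/= [S1 S2 S3] ne' minf]] :=
  @ex_min_val _ (fun t => [/\ R t.1.1, R t.1.2 & R t.2])
    (fun t => trip t.1.1 t.1.2 t.2) 0.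
- by exists ((e1, e2), e3).
- move=> [[x y] z] /= [Rx Ry Rz]; apply: (order_tr hR).
  by apply: (orderM hR) => //; apply: (orderB hR); apply: (orderM hR).
exists f1, f2, f3; split=> //; split=> // y Ry.
- exact: (minf ((y, f2), f3)).
- by rewrite -(tripC f1 y f3); apply: (minf ((f1, y), f3)).
- by rewrite (tripC y f1 f2); apply: (minf ((f1, f2), y)).
Qed.

(** * The codifferent *)

Lemma lattice_transport (phi psi : {linear 'M[K]_2 -> 'M[K]_2}) R S :
  cancel psi phi -> cancel phi psi -> (forall a, S a <-> R (psi a)) ->
  is_lattice v R -> is_lattice v S.
Proof.
move=> psiK phiK SR [[s hs] sp].
have key (c : nat -> K) (r : seq 'M[K]_2) : phi (\sum_(i < size r) c i *: r`_i) =
    \sum_(i < size (map phi r)) c i *: (map phi r)`_i.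
  rewrite linear_sum -(big_mkord xpredT (fun i => phi (c i *: r`_i))).
  rewrite -(big_mkord xpredT (fun i => c i *: (map phi r)`_i)) size_map.
  by apply: eq_big_nat => i /andP [_ ir]; rewrite linearZ (nth_map 0).
split.
  exists (map phi s) => a; rewrite SR hs; split=> -[c [cO E]]; exists c; split=> //.
    by rewrite -key -E psiK.
  by rewrite E -key phiK.
move=> a; have [s' [c [s'R E]]] := sp (psi a); exists (map phi s'), c; split.
  by move=> x /mapP [y /s'R Ry ->]; apply/SR; rewrite phiK.
by rewrite -key -E psiK.
Qed.

Lemma order_sum R (I : eqType) (s : seq I) (F : I -> 'M[K]_2) : is_order v R ->
  (forall i, i \in s -> R (F i)) -> R (\sum_(i <- s) F i).
Proof.
move=> hR h; rewrite big_seq; elim/big_ind: _ => //.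
- by rewrite -(subrr 1); apply: (orderB hR); apply: (order1 hR).
- exact: (orderD hR).
Qed.

(* The inverse ideal is generated by [xi] on both sides. *)
Lemma Gorenstein_of_generator R x xi : is_full_order v R ->
  x * xi = 1 -> xi * x = 1 ->
  (forall a, codifferent v R a <-> R (a * xi)) ->
  (forall a, codifferent v R a <-> R (xi * a)) -> Gorenstein v R.
Proof.
move=> fR xxi xix hr hl; split=> //; have [hR sR] := fR.
have lR : is_lattice v R by split=> //; case: hR.
(* The two descriptions of the codifferent, as $Rx$ and as $xR$, say that [x] normalizes [R]. *)
have swap a : R (x * a) <-> R (a * x).
  split=> h.
    have /hl : codifferent v R (x * a * x) by apply/hr; rewrite -!mulrA xxi mulr1.
    by rewrite -mulrA mulrA xix mul1r.
  have /hr : codifferent v R (x * (a * x)) by apply/hl; rewrite mulrA xix mul1r.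
  by rewrite -!mulrA xxi mulr1.
have conjR h : R h -> R (x * h * xi).
  by move=> Rh; apply/hr/hl; rewrite mulrA xix mul1r.
have conjR' h : R h -> R (xi * (h * x)).
  by move=> Rh; apply/hl/hr; rewrite -mulrA xxi mulr1.
split.
  split.
  - apply: (@lattice_transport (mulmxr x) (mulmxr xi)) hr lR => a /=.
      by rewrite -mulmxA; have := xix; rewrite -[_ * _]/(mulmx _ _) => ->; rewrite mulmx1.
    by rewrite -mulmxA; have := xxi; rewrite -[_ * _]/(mulmx _ _) => ->; rewrite mulmx1.
  - by move=> h a Rh /hr Ra; apply/hr; rewrite -mulrA; apply: (orderM hR).
  - by move=> h a Rh /hl Ra; apply/hl; rewrite mulrA; apply: (orderM hR).
exists (fun a => R (x * a)); split; last split.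
- split.
  + apply: (@lattice_transport (mulmx xi) (mulmx x)) lR => // a /=.
      by rewrite mulmxA; have := xix; rewrite -[_ * _]/(mulmx _ _) => ->; rewrite mul1mx.
    by rewrite mulmxA; have := xxi; rewrite -[_ * _]/(mulmx _ _) => ->; rewrite mul1mx.
  + move=> h a Rh Ra; rewrite (_ : x * (h * a) = (x * h * xi) * (x * a)).
      by apply: (orderM hR) => //; apply: conjR.
    by rewrite !mulrA -[_ * xi * x]mulrA xix mulr1.
  + by move=> h a Rh Ra; rewrite mulrA; apply: (orderM hR).
- move=> z; split=> [[s [sP ->]]|Rz].
    apply: (order_sum hR) => p /sP [/hr Ra Rb].
    rewrite (_ : p.1 * p.2 = (p.1 * xi) * (x * p.2)); first exact: (orderM hR).
    by rewrite !mulrA -[_ * xi * x]mulrA xix mulr1.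
  exists [:: (z * x, xi)]; split.
    move=> p; rewrite inE => /eqP -> /=; rewrite xxi; split; last exact: (order1 hR).
    by apply/hr; rewrite -mulrA xxi mulr1.
  by rewrite big_seq1 /= -mulrA xxi mulr1.
- move=> z; split=> [[s [sP ->]]|Rz].
    apply: (order_sum hR) => p /sP [/swap Ra /hl Rb].
    rewrite (_ : p.1 * p.2 = (p.1 * x) * (xi * p.2)); first exact: (orderM hR).
    by rewrite !mulrA -[_ * x * xi]mulrA xxi mulr1.
  exists [:: (xi, x * z)]; split.
    move=> p; rewrite inE => /eqP -> /=; rewrite xxi; split; first exact: (order1 hR).
    by apply/hl; rewrite mulrA xix mul1r.
  by rewrite big_seq1 /= mulrA xix mul1r.
Qed.

(* [1, e1, e2, e3] is an O-basis of [R]: the trace-dual vectors of [e1, e2, e3]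
   are [dual e1 e2 e3] and its rotations. *)
Definition adapted R e1 e2 e3 : Prop :=
  [/\ R e1, R e2 & R e3] /\ [/\ trip e1 e2 e3 != 0,
    codifferent v R (dual e1 e2 e3),
    codifferent v R (dual e2 e3 e1) & codifferent v R (dual e3 e1 e2)].

Lemma adapted_rot R e1 e2 e3 : adapted R e1 e2 e3 -> adapted R e2 e3 e1.
Proof. by move=> [[? ? ?] [ne ? ? ?]]; split; split=> //; rewrite -tripC. Qed.

Lemma adapted_exists R : is_full_order v R -> exists e1 e2 e3, adapted R e1 e2 e3.
Proof.
move=> fR; have [e1 [e2 [e3 [hR [ne c1 c2 c3]]]]] := full_order_basis fR.
exists e1, e2, e3; split=> //; split=> // y Ry; rewrite mxtrace_mulC -[_ *m _]/(_ * _).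
- by rewrite tr_mul_dual; apply: c1.
- by rewrite tr_mul_dual -(tripC e1 e2 e3); apply: c2.
- by rewrite tr_mul_dual (tripC e3 e1 e2); apply: c3.
Qed.

Section Adapted.
Variables (R : mxset K) (fR : is_full_order v R).
Let hR : is_order v R := proj1 fR.

Lemma codifferentP a y : codifferent v R a -> R y -> iO (\tr (y * a)).
Proof. by move=> ca Ry; rewrite mxtrace_mulC; apply: ca. Qed.

Lemma adapted_expand e1 e2 e3 y : adapted R e1 e2 e3 -> R y ->
  exists k c1 c2 c3, [/\ iO k, iO c1, iO c2 & iO c3] /\
    y = k *: 1 + c1 *: e1 + c2 *: e2 + c3 *: e3.
Proof.
move=> [[R1 R2 R3] [ne c1 c2 c3]] Ry; have [k E] := trip_expand e1 e2 e3 y.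
have {}E : y = (k / trip e1 e2 e3) *: 1 + \tr (y * dual e1 e2 e3) *: e1
    + \tr (y * dual e2 e3 e1) *: e2 + \tr (y * dual e3 e1 e2) *: e3.
  rewrite !tr_mul_dual (tripC e3 e1 e2) -(tripC e1 e2 e3).
  move: (trip e1 e2 e3) (trip y e2 e3) (trip y e3 e1) (trip y e1 e2) ne E.
  move=> D t1 t2 t3 D0 E; apply: (scalerI D0).
  by rewrite E !scalerDr !scalerA ![D * _]mulrC !divfK.
have O1 := codifferentP c1 Ry; have O2 := codifferentP c2 Ry.
have O3 := codifferentP c3 Ry.
exists (k / trip e1 e2 e3), (\tr (y * dual e1 e2 e3)), (\tr (y * dual e2 e3 e1)),
  (\tr (y * dual e3 e1 e2)); split=> //; split=> //.
(* The scalar coefficient is not one of the pairings; it is integral because the corresponding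
   multiple of 1 is a difference of elements of [R]. *)
apply: (order_scalar_inv hR).
have -> : (k / trip e1 e2 e3) *: 1 = y - \tr (y * dual e3 e1 e2) *: e3
    - \tr (y * dual e2 e3 e1) *: e2 - \tr (y * dual e1 e2 e3) *: e1.
  by apply/eqP; rewrite eq_sym !subr_eq; apply/eqP.
by do 3!(apply: (orderB hR); last exact: (orderZ hR)).
Qed.

Lemma adapted_prod e1 e2 e3 : adapted R e1 e2 e3 -> exists s, iO s /\
  e1 = s *: 1 - trip e1 e2 e3 *: (dual e2 e3 e1 * dual e3 e1 e2).
Proof.
move=> [[R1 R2 R3] [ne c1 c2 c3]].
exists (\tr (dual e2 e3 e1 * e1 * e2)); split.
  by rewrite -mulrA; apply: c2; apply: (orderM hR).
by rewrite dual_mul_dual // opprB addrC subrK.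
Qed.

(** With the next lemma and rotations: the form [D * \det], for [D] the value of [trip], is integral
    on the span of the dual vectors. Diagonal values pair a dual vector with a product in [R], polar
    ones with a commutator in [R]. *)
Lemma adapted_det e1 e2 e3 : adapted R e1 e2 e3 ->
  iO (trip e1 e2 e3 * \det (dual e1 e2 e3)).
Proof.
move=> [[R1 R2 R3] [ne c1 c2 c3]]; rewrite det_dual //; apply: iON.
by rewrite -mulrA; apply: c1; apply: (orderM hR).
Qed.

Lemma adapted_tr e1 e2 e3 : adapted R e1 e2 e3 ->
  iO (trip e1 e2 e3 * \tr (dual e1 e2 e3 * dual e2 e3 e1)).
Proof.
move=> [[R1 R2 R3] [ne c1 c2 c3]]; rewrite -mxtraceZ scalerAl scale_dual //.
by apply: codifferentP => //; apply: (orderB hR); apply: (orderM hR).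
Qed.

(** A square gives an integral scalar, a product of consecutive dual vectors gives an integral
    scalar minus a basis vector, and anticommutation gives the reversed product. *)
Lemma adapted_mul_dual e1 e2 e3 : adapted R e1 e2 e3 ->
  [/\ R (trip e1 e2 e3 *: (dual e1 e2 e3 * dual e1 e2 e3)),
      R (trip e1 e2 e3 *: (dual e1 e2 e3 * dual e2 e3 e1))
    & R (trip e1 e2 e3 *: (dual e2 e3 e1 * dual e1 e2 e3))].
Proof.
move=> ad; have O1 := adapted_det ad; have O2 := adapted_tr ad.
have [s [Os E]] := adapted_prod (adapted_rot (adapted_rot ad)).
have [[R1 R2 R3] [ne c1 c2 c3]] := ad.
have RE : R (trip e1 e2 e3 *: (dual e1 e2 e3 * dual e2 e3 e1)).
  rewrite -(tripC e3 e1 e2) (_ : _ *: _ = s *: 1 - e3).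
    by apply: (orderB hR) => //; apply: (order_scalar hR).
  by move/eqP: E; rewrite eq_sym subr_eq [e3 + _]addrC -subr_eq => /eqP ->.
split=> //.
- rewrite traceless_sq ?tr_dual // scalerA mulrN.
  exact/(order_scalar hR)/iON.
- rewrite (_ : _ * _ = \tr (dual e1 e2 e3 * dual e2 e3 e1) *: 1
     - dual e1 e2 e3 * dual e2 e3 e1); last first.
    by rewrite -traceless_anticomm ?tr_dual // addrAC subrr add0r.
  rewrite scalerBr scalerA; apply: (orderB hR) => //.
  exact: (order_scalar hR).
Qed.

Lemma codifferent_mull r a : R r -> codifferent v R a -> codifferent v R (r * a).
Proof.
move=> Rr ca s Rs; rewrite -mulrA mxtrace_mulC -[_ *m _]/(_ * _) -mulrA.
by apply: ca; apply: (orderM hR).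
Qed.
Lemma codifferent_mulr r a : R r -> codifferent v R a -> codifferent v R (a * r).
Proof. by move=> Rr ca s Rs; rewrite -mulrA; apply: ca; apply: (orderM hR). Qed.
Lemma codifferentD a b :
  codifferent v R a -> codifferent v R b -> codifferent v R (a + b).
Proof.
move=> ca cb r Rr; rewrite mulrDl mxtraceD; apply: iOD; [exact: ca|exact: cb].
Qed.
Lemma codifferentZ k a : iO k -> codifferent v R a -> codifferent v R (k *: a).
Proof.
by move=> kO ca r Rr; rewrite -scalerAl mxtraceZ; apply: iOM => //; apply: ca.
Qed.

(* Subtracting a multiple of [x] from an element of the codifferent makes it
   traceless, and the traceless part times [x^-1] is integral. *)
Lemma Gorenstein_of_traceless D x e : R e -> codifferent v R x ->
  \tr x = 0 -> \tr (e * x) = 1 -> D * \det x != 0 -> v (D * \det x) = 0 ->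
  (forall a, codifferent v R a -> \tr a = 0 ->
     R (D *: (a * x)) /\ R (D *: (x * a))) ->
  Gorenstein v R.
Proof.
set u := D * \det x => Re cx tx ex u0 vu h.
have /andP [D0 d0] : (D != 0) && (\det x != 0).
  by move: u0; rewrite /u mulf_eq0 negb_or.
(* This is the inverse of [x], since a traceless [x] squares to [- \det x]; writing it with the unit
   [u] leaves only the factor [D] to be absorbed. *)
pose xi := - (u^-1 * D) *: x.
have uO : iO (- u^-1) by apply: iON; right; rewrite vV // vu.
have xxi : x * xi = 1.
  rewrite /xi -scalerAr traceless_sq // scalerA mulrNN.
  by rewrite (_ : _ * _ = 1) ?scale1r // /u; field; rewrite D0 d0.
have xix : xi * x = 1.
  by rewrite -[RHS]xxi /xi -scalerAl -scalerAr.
have xl r : codifferent v R r -> R (r * xi).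
  move=> cr; have tO : iO (\tr r) by have := cr 1 (order1 hR); rewrite mulr1.
  pose r' := r - (\tr r *: e) * x.
  have -> : r = r' + (\tr r *: e) * x by rewrite subrK.
  rewrite mulrDl -(mulrA _ x) xxi mulr1; apply: (orderD hR); last exact: (orderZ hR).
  have [||+ _] := h r'.
  - apply: codifferentD => //; rewrite -mulNr; apply: codifferent_mull => //.
    by apply: (orderN hR); apply: (orderZ hR).
  - by rewrite /r' raddfB /= -scalerAl mxtraceZ ex mulr1 subrr.
  by move=> Rr'; rewrite /xi -scalerAr -mulNr -scalerA; apply: (orderZ hR).
have xr r : codifferent v R r -> R (xi * r).
  move=> cr; have tO : iO (\tr r) by have := cr 1 (order1 hR); rewrite mulr1.
  pose r' := r - x * (\tr r *: e).
  have -> : r = r' + x * (\tr r *: e) by rewrite subrK.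
  rewrite mulrDr mulrA xix mul1r; apply: (orderD hR); last exact: (orderZ hR).
  have [||_] := h r'.
  - apply: codifferentD => //; rewrite -mulrN; apply: codifferent_mulr => //.
    by apply: (orderN hR); apply: (orderZ hR).
  - rewrite /r' raddfB /= -scalerAr mxtraceZ [\tr (x * e)]mxtrace_mulC.
    by rewrite -[_ *m _]/(_ * _) ex mulr1 subrr.
  by move=> Rr'; rewrite /xi -scalerAl -mulNr -scalerA; apply: (orderZ hR).
apply: (Gorenstein_of_generator fR xxi xix) => a; split.
- exact: xl.
- by move=> Ra; rewrite -[a]mulr1 -xix mulrA; apply: codifferent_mull.
- exact: xr.
- by move=> Ra; rewrite -[a]mul1r -xxi -mulrA; apply: codifferent_mulr.
Qed.

Lemma order_mul_span D t1 t2 t3 b d1 d2 d3 : iO t1 -> iO t2 -> iO t3 -> iO b ->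
  R (D *: (d1 * d1)) -> R (D *: (d1 * d2)) -> R (D *: (d2 * d1)) ->
  R (D *: (d2 * d2)) -> R (D *: (d2 * d3)) -> R (D *: (d3 * d2)) ->
  R (D *: (d3 * d1)) -> R (D *: (d1 * d3)) ->
  R (D *: ((t1 *: d1 + t2 *: d2 + t3 *: d3) * (d1 + b *: d2))) /\
  R (D *: ((d1 + b *: d2) * (t1 *: d1 + t2 *: d2 + t3 *: d3))).
Proof.
move=> *.
have Zl k x y : iO k -> R (D *: (x * y)) ->
    R (D *: (k *: x * y)).
  by move=> kO h; rewrite -scalerAl scalerA mulrC -scalerA; apply: (orderZ hR).
have Zr k x y : iO k -> R (D *: (x * y)) ->
    R (D *: (x * (k *: y))).
  by move=> kO h; rewrite -scalerAr scalerA mulrC -scalerA; apply: (orderZ hR).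
have Dl x y z : R (D *: (x * z)) -> R (D *: (y * z)) ->
    R (D *: ((x + y) * z)).
  by move=> h h'; rewrite mulrDl scalerDr; apply: (orderD hR).
have Dr x y z : R (D *: (z * x)) -> R (D *: (z * y)) ->
    R (D *: (z * (x + y))).
  by move=> h h'; rewrite mulrDr scalerDr; apply: (orderD hR).
split.
  by apply: (Dr); [|apply: (Zr) => //]; do 2?[apply: (Dl)]; apply: (Zl).
by apply: (Dl); [|apply: (Zl) => //]; do 2?[apply: (Dr)]; apply: (Zr).
Qed.

(** The tested element of the codifferent pairs to 1 with [e1] for every [b]. The choices [b = 0]
    and [b = 1] will detect unit diagonal values and unit polar values of the form. *)
Lemma Gorenstein_of_unit e1 e2 e3 b : adapted R e1 e2 e3 -> iO b ->
  let u := trip e1 e2 e3 * \det (dual e1 e2 e3 + b *: dual e2 e3 e1) in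
  u != 0 -> v u = 0 -> Gorenstein v R.
Proof.
move=> ad bO; have [[R1 R2 R3] [ne c1 c2 c3]] := ad => u u0 vu.
apply: (@Gorenstein_of_traceless _ (dual e1 e2 e3 + b *: dual e2 e3 e1) e1 R1 _ _ _ u0 vu) => //.
- by apply: codifferentD => //; apply: codifferentZ.
- by rewrite mxtraceD tr_dual (mxtraceZ b) tr_dual mulr0 addr0.
- rewrite mulrDr mxtraceD tr_mul_dual_self // -(scalerAr b) (mxtraceZ b).
  by rewrite tr_mul_dual_prev mulr0 addr0.
move=> a ca ta; rewrite (dual_expand ne ta).
have a1 := ca _ R1; have a2 := ca _ R2; have a3 := ca _ R3.
have [p11 p12 p21] := adapted_mul_dual ad.
have [p22 p23 p32] := adapted_mul_dual (adapted_rot ad).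
have [_ p31 p13] := adapted_mul_dual (adapted_rot (adapted_rot ad)).
rewrite -!(tripC e1 e2 e3) in p22 p23 p32 p31 p13.
rewrite !(tripC e3 e1 e2) in p31 p13.
exact: order_mul_span p11 p12 p21 p22 p23 p32 p31 p13.
Qed.

End Adapted.

Lemma Kspans_mono R S : subsetM R S -> Kspans R -> Kspans S.
Proof.
move=> RS h a; have [s [c [sR ->]]] := h a; exists s, c; split=> // x /sR; exact: RS.
Qed.

Lemma fgD S x y : fg_Omodule v S -> S x -> S y -> S (x + y).
Proof.
move=> [s hs] /hs [c [cO ->]] /hs [c' [cO' ->]]; apply/hs.
exists (fun i => c i + c' i); split=> [i|]; first exact: iOD.
by rewrite -big_split; apply: eq_bigr => i _; rewrite scalerDl.
Qed.

(** * Non-Gorenstein orders *)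

Definition span4 f1 f2 f3 : mxset K := fun a =>
  exists k c1 c2 c3, [/\ iO k, iO c1, iO c2 & iO c3] /\
    a = k *: 1 + c1 *: f1 + c2 *: f2 + c3 *: f3.

Lemma span4_rot f1 f2 f3 a : span4 f1 f2 f3 a -> span4 f2 f3 f1 a.
Proof.
move=> [k [c1 [c2 [c3 [[? ? ? ?] ->]]]]]; exists k, c2, c3, c1; split=> //.
by rewrite -!addrA; congr (_ + _); rewrite addrC -addrA.
Qed.

Lemma span4_fg f1 f2 f3 : fg_Omodule v (span4 f1 f2 f3).
Proof.
exists [:: 1; f1; f2; f3] => a; split.
  move=> [k [c1 [c2 [c3 [[? ? ? ?] ->]]]]].
  exists (nth 0 [:: k; c1; c2; c3]); split.
    by do 4?[case=> //] => i; rewrite nth_default //; apply: iO0.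
  by rewrite !big_ord_recr big_ord0 /= add0r.
move=> [c [cO ->]]; exists (c 0%N), (c 1%N), (c 2%N), (c 3%N); split=> //.
by rewrite !big_ord_recr big_ord0 /= add0r.
Qed.

Lemma span4_gen f1 f2 f3 : [/\ span4 f1 f2 f3 1, span4 f1 f2 f3 f1,
  span4 f1 f2 f3 f2 & span4 f1 f2 f3 f3].
Proof.
have O0 := iO0; have O1 := iO1; split.
- by exists 1, 0, 0, 0; split=> //; rewrite !scale0r scale1r !addr0.
- by exists 0, 1, 0, 0; split=> //; rewrite !scale0r scale1r !addr0 add0r.
- by exists 0, 0, 1, 0; split=> //; rewrite !scale0r scale1r !addr0 add0r.
- by exists 0, 0, 0, 1; split=> //; rewrite !scale0r scale1r !add0r.
Qed.

Lemma span4_order f1 f2 f3 (S := span4 f1 f2 f3) :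
  S (f1 * f1) -> S (f1 * f2) -> S (f1 * f3) ->
  S (f2 * f1) -> S (f2 * f2) -> S (f2 * f3) ->
  S (f3 * f1) -> S (f3 * f2) -> S (f3 * f3) -> is_order v S.
Proof.
move=> h11 h12 h13 h21 h22 h23 h31 h32 h33.
have fS : fg_Omodule v S := span4_fg f1 f2 f3.
have [S1 Sf1 Sf2 Sf3] := span4_gen f1 f2 f3.
have SD x y : S x -> S y -> S (x + y) by apply: fgD.
have SZ k x : iO k -> S x -> S (k *: x) by apply: fg_scale.
have mulS f : S f -> S (f * f1) -> S (f * f2) -> S (f * f3) ->
    forall y, S y -> S (f * y).
  move=> Sf hf1 hf2 hf3 y [k [c1 [c2 [c3 [[? ? ? ?] ->]]]]].
  rewrite !mulrDr -!scalerAr mulr1.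
  by do 3!(apply: (SD); last exact: (SZ)); apply: (SZ).
split=> //.
- by move=> a Sa; rewrite -scaleN1r; apply: (SZ) => //; apply/iON/iO1.
move=> a b [k [c1 [c2 [c3 [[? ? ? ?] ->]]]]] Sb.
rewrite !mulrDl -!scalerAl mul1r.
by do 3!(apply: (SD); last by apply: (SZ) => //; apply: (mulS)); apply: (SZ).
Qed.

(* The even Clifford algebra of the integral form [l * det] on the lattice
   spanned by the traceless matrices [x, y, z]. *)
Lemma clifford_order l x y z : \tr x = 0 -> \tr y = 0 -> \tr z = 0 ->
  iO (l * \det x) -> iO (l * \det y) -> iO (l * \det z) ->
  iO (l * \tr (x * y)) -> iO (l * \tr (y * z)) -> iO (l * \tr (z * x)) ->
  is_order v (span4 (l *: (y * z)) (l *: (z * x)) (l *: (x * y))).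
Proof.
(* Three of the nine products of generators; the other six follow from the two cyclic rotations of
   [x], [y], [z]. *)
have step a b c : \tr a = 0 -> \tr b = 0 -> \tr c = 0 ->
    iO (l * \det b) -> iO (l * \det c) ->
    iO (l * \tr (a * b)) -> iO (l * \tr (b * c)) -> iO (l * \tr (c * a)) ->
  let S := span4 (l *: (b * c)) (l *: (c * a)) (l *: (a * b)) in
  [/\ S (l *: (b * c) * (l *: (b * c))), S (l *: (b * c) * (l *: (c * a)))
    & S (l *: (c * a) * (l *: (b * c)))].
  move=> ta tb tc pb pc tab tbc tca S.
  have fS : fg_Omodule v S by apply: span4_fg.
  have SZ k (t : 'M[K]_2) : iO k -> S t -> S (k *: t) by apply: fg_scale.
  have SD (s t : 'M[K]_2) : S s -> S t -> S (s + t) by apply: fgD.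
  have SB (s t : 'M[K]_2) : S s -> S t -> S (s - t).
    by move=> hu hw; rewrite -scaleN1r; apply: (SD) => //; apply: (SZ) => //; apply/iON/iO1.
  have [S1 Sf1 Sf2 Sf3] :
    [/\ S 1, S (l *: (b * c)), S (l *: (c * a)) & S (l *: (a * b))].
    exact: span4_gen.
  have sq2 (u w : 'M[K]_2) : l *: u * (l *: w) = l *: (l *: (u * w)).
    by rewrite -scalerAl -scalerAr.
  have sh k (u : 'M[K]_2) : l *: (l *: (k *: u)) = (l * k) *: (l *: u).
    by rewrite !scalerA mulrAC -mulrA.
  have sh1 k m : l *: (l *: ((k * m) *: 1)) = (l * k * (l * m)) *: 1 :> 'M[K]_2.
    by rewrite !scalerA mulrACA mulrA.
  have OM k m : iO (l * k) -> iO (l * m) -> S ((l * k * (l * m)) *: 1).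
    by move=> ? ?; apply: (SZ) => //; apply: iOM.
  split; rewrite sq2.
  - by rewrite clifford_diag !scalerBr sh1 sh; apply: (SB); [apply: (SZ)|apply: OM].
  - rewrite clifford_next // !scalerBr sh1 sh.
    by apply: (SB); [apply: (SZ)|apply: OM].
  - rewrite clifford_prev // !(scalerBr, scalerDr) sh1 !sh.
    by apply: (SB); [apply: (SD); [apply: (SB); [|apply: OM]|]|]; try apply: (SZ).
move=> tx ty tz px py pz txy tyz tzx.
have [a11 a12 a21] := step x y z tx ty tz py pz txy tyz tzx.
have [a22 a23 a32] := step y z x ty tz tx pz px tyz tzx txy.
have [a33 a31 a13] := step z x y tz tx ty px py tzx txy tyz.
move/span4_rot/span4_rot in a22; move/span4_rot/span4_rot in a23.
move/span4_rot/span4_rot in a32.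
move/span4_rot in a33; move/span4_rot in a31; move/span4_rot in a13.
exact: span4_order.
Qed.

Lemma adapted_det_dichotomy R e1 e2 e3 : is_full_order v R -> adapted R e1 e2 e3 ->
  Gorenstein v R \/ vge 1 (trip e1 e2 e3 * \det (dual e1 e2 e3)).
Proof.
move=> fR ad; case: (iO_unitP (adapted_det fR ad)) => [[u0 vu]|]; last by right.
left; have := Gorenstein_of_unit fR ad iO0.
by rewrite scale0r addr0; apply.
Qed.

(** Polarization: if the form is a non-unit at two dual vectors but their polar value is a unit,
    then the form takes a unit value at their sum. *)
Lemma adapted_tr_dichotomy R e1 e2 e3 (D := trip e1 e2 e3) :
  is_full_order v R -> adapted R e1 e2 e3 ->
  vge 1 (D * \det (dual e1 e2 e3)) -> vge 1 (D * \det (dual e2 e3 e1)) ->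
  Gorenstein v R \/ vge 1 (D * \tr (dual e1 e2 e3 * dual e2 e3 e1)).
Proof.
move=> fR ad q1 q2; case: (iO_unitP (adapted_tr fR ad)) => [[u0 vu]|]; last by right.
left; have := Gorenstein_of_unit fR ad iO1.
rewrite scale1r det_add !tr_dual mul0r sub0r -/D.
set t := \tr (_ * _) in u0 vu *.
set q := D * (_ + - t); rewrite -/D in u0 vu.
have E : D * t = D * \det (dual e1 e2 e3) + D * \det (dual e2 e3 e1) - q.
  by rewrite /q; ring.
have qO : iO q.
  rewrite /q mulrDr mulrN; apply: iOB; last exact: (adapted_tr fR ad).
  by rewrite mulrDr; apply: iOD; [exact: vge_le q1|exact: vge_le q2].
case: (iO_unitP qO) => [[q0 vq]|q1'] G; first exact: G.
have : vge 1 (D * t) by rewrite E; apply: vgeB => //; apply: vgeD.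
by move/vge_inv => /(_ u0); rewrite vu.
Qed.

Definition thicken S : mxset K := fun y =>
  exists k r, [/\ iO k, S r & y = k *: 1 + pi *: r].

Lemma thick_combination d k c1 c2 c3 s1 s2 s3 (x1 x2 x3 : 'M[K]_2) :
  k *: 1 + c1 *: (s1 *: 1 - d *: x1) + c2 *: (s2 *: 1 - d *: x2)
    + c3 *: (s3 *: 1 - d *: x3) =
  (k + c1 * s1 + c2 * s2 + c3 * s3) *: 1
    + pi *: - (c1 *: (d / pi *: x1) + c2 *: (d / pi *: x2) + c3 *: (d / pi *: x3)).
Proof.
mx2_split x1; mx2_split x2; mx2_split x3.
by rewrite !mkEs; congr mk; field.
Qed.

Lemma Gorenstein_or_thick R : is_full_order v R ->
  Gorenstein v R \/ exists R', is_full_order v R' /\ subsetM R (thicken R').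
Proof.
move=> fR; have [hR sR] := fR; have [e1 [e2 [e3 ad1]]] := adapted_exists fR.
have ad2 := adapted_rot ad1; have ad3 := adapted_rot ad2.
have [G|q1] := adapted_det_dichotomy fR ad1; first by left.
have [G|q2] := adapted_det_dichotomy fR ad2; first by left.
have [G|q3] := adapted_det_dichotomy fR ad3; first by left.
have e2E := tripC e1 e2 e3; have e3E := tripC e3 e1 e2.
rewrite -e2E in q2; rewrite e3E in q3.
have [|G|t1] := adapted_tr_dichotomy fR ad1 q1; [exact: q2|by left|].
have [||G|t2] := adapted_tr_dichotomy fR ad2; [by rewrite -e2E|by rewrite -e2E|by left|].
have [||G|t3] := adapted_tr_dichotomy fR ad3; [by rewrite e3E|by rewrite e3E|by left|].
rewrite -e2E in t2; rewrite e3E in t3.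
have pO D k : vge 1 (D * k) -> iO (D / pi * k) by rewrite mulrAC; apply: vge1_pi.
right; set D := trip e1 e2 e3 in q1 q2 q3 t1 t2 t3 e2E e3E.
have [td1 td2 td3] := And3 (tr_dual e1 e2 e3) (tr_dual e2 e3 e1) (tr_dual e3 e1 e2).
(* All six coefficients of the form are now divisible by [pi], so [D / pi * \det] is integral and
   has an even Clifford algebra. *)
have oR' := clifford_order td1 td2 td3 (pO _ _ q1) (pO _ _ q2) (pO _ _ q3)
  (pO _ _ t1) (pO _ _ t2) (pO _ _ t3).
set R' := span4 _ _ _ in oR'.
have [S1 Sf1 Sf2 Sf3] := span4_gen (D / pi *: (dual e2 e3 e1 * dual e3 e1 e2))
  (D / pi *: (dual e3 e1 e2 * dual e1 e2 e3)) (D / pi *: (dual e1 e2 e3 * dual e2 e3 e1)).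
have RR' : subsetM R (thicken R').
  move=> y Ry.
  have [k [c1 [c2 [c3 [[kO O1 O2 O3] ->]]]]] := adapted_expand fR ad1 Ry.
  have [s1 [s1O E1]] := adapted_prod fR ad1; have [s2 [s2O E2]] := adapted_prod fR ad2.
  have [s3 [s3O E3]] := adapted_prod fR ad3.
  rewrite -e2E in E2; rewrite e3E in E3; rewrite -/D in E1.
  exists (k + c1 * s1 + c2 * s2 + c3 * s3).
  exists (- (c1 *: (D / pi *: (dual e2 e3 e1 * dual e3 e1 e2))
    + c2 *: (D / pi *: (dual e3 e1 e2 * dual e1 e2 e3))
    + c3 *: (D / pi *: (dual e1 e2 e3 * dual e2 e3 e1)))).
  split.
  - by do 3?[apply: iOD]=> //; apply: iOM.
  - apply: (orderN oR'); do 2?[apply: (orderD oR')];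
      by apply: (orderZ oR').
  - by rewrite -thick_combination -E1 -E2 -E3.
(* [R'] spans because it contains [thicken R'], hence [R]. *)
exists R'; split=> //; split=> //; apply: Kspans_mono sR => y /RR' [k [r [kO Rr ->]]].
apply: (orderD oR'); first exact: (order_scalar oR').
by apply: (orderZ oR') => //; apply: iO_pi.
Qed.

(** * Maximal orders and the tree *)

Notation unitm g := (is_true (g \in unitmx)).

Lemma mulVg g : unitm g -> invmx g * g = 1. Proof. exact: mulVmx. Qed.
Lemma mulgV g : unitm g -> g * invmx g = 1. Proof. exact: mulmxV. Qed.
Lemma unitmM g h : unitm g -> unitm h -> unitm (g * h).
Proof. by move=> ug uh; rewrite -[g * h]/(g *m h) unitmx_mul ug. Qed.
Lemma unitm_det g : \det g != 0 -> unitm g.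
Proof. by move=> ?; rewrite unitmxE unitfE. Qed.
Lemma det_unitm g : unitm g -> \det g != 0.
Proof. by rewrite unitmxE unitfE. Qed.
Lemma invmx_uniq g h : g * h = 1 -> unitm g /\ invmx g = h.
Proof.
move=> gh; have ug : unitm g by case: (mulmx1_unit gh).
by split=> //; rewrite -[invmx g]mulr1 -gh mulrA mulVg // mul1r.
Qed.
Lemma invmM g h : unitm g -> unitm h -> invmx (g * h) = invmx h * invmx g.
Proof.
move=> ug uh; apply: (proj2 (invmx_uniq _)).
by rewrite mulrA -(mulrA g) mulgV // mulr1 mulgV.
Qed.
Lemma mxtrace_conj g x : unitm g -> \tr (invmx g * x * g) = \tr x.
Proof. by move=> ug; rewrite mxtrace_mulC -[_ *m _]/(_ * _) mulrA mulgV // mul1r. Qed.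

Notation M2O := (M2O v).

Lemma M2OP a b c d : M2O (mk a b c d) <-> [/\ iO a, iO b, iO c & iO d].
Proof.
split=> [h|[? ? ? ?]].
  have := (h ord0 ord0, h ord0 ord_max, (h ord_max ord0, h ord_max ord_max)).
  by rewrite !mkE => -[[? ?] [? ?]].
by apply: ord2P; apply: ord2P; rewrite mkE.
Qed.

Lemma M2OM x y : M2O x -> M2O y -> M2O (x * y).
Proof.
move=> hx hy i j; rewrite mxE; apply: vge_sum => k.
by apply: iOM; [apply: hx|apply: hy].
Qed.
Lemma M2OD x y : M2O x -> M2O y -> M2O (x + y).
Proof. by move=> hx hy i j; rewrite mxE; apply: iOD; [apply: hx|apply: hy]. Qed.
Lemma M2ON x : M2O x -> M2O (- x).
Proof. by move=> hx i j; rewrite mxE; apply/iON/hx. Qed.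
Lemma M2OZ k x : iO k -> M2O x -> M2O (k *: x).
Proof. by move=> kO hx i j; rewrite mxE; apply: iOM => //; apply: hx. Qed.
Lemma M2O1 : M2O 1.
Proof. by rewrite mk1; apply/M2OP; split; [apply: iO1|apply: iO0|apply: iO0|apply: iO1]. Qed.

Lemma mk_units a b c d : mk a b c d = a *: mk 1 0 0 0 + b *: mk 0 1 0 0
  + c *: mk 0 0 1 0 + d *: mk 0 0 0 1 :> 'M[K]_2.
Proof. by rewrite !mkEs; congr mk; ring. Qed.

Lemma M2O_lattice : is_lattice v M2O.
Proof.
pose s : seq 'M[K]_2 := [:: mk 1 0 0 0; mk 0 1 0 0; mk 0 0 1 0; mk 0 0 0 1].
have sE (c : nat -> K) :
    \sum_(i < size s) c i *: s`_i = mk (c 0%N) (c 1%N) (c 2%N) (c 3%N).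
  by rewrite !big_ord_recr big_ord0 /= add0r -mk_units.
have O0 := iO0; have O1 := iO1.
split.
  exists s => x; have [a [b [c [d ->]]]] := mkP x; split.
    move=> /M2OP [? ? ? ?]; exists (nth 0 [:: a; b; c; d]); rewrite sE; split=> //.
    by do 4?[case=> //] => i; rewrite nth_default.
  by move=> [c' [cO ->]]; rewrite sE; apply/M2OP.
move=> x; have [a [b [c [d ->]]]] := mkP x.
exists s, (nth 0 [:: a; b; c; d]); rewrite sE; split=> //.
by move=> y; rewrite !inE => /or4P [] /eqP ->; apply/M2OP.
Qed.

(** The endomorphism ring of the lattice $g\mathcal O_K^2$ spanned by the columns of [g]. *)
Notation V g := (conj_set g M2O).

Lemma VP g a : unitm g -> V g a <-> M2O (invmx g * a * g).
Proof.
move=> ug; split=> [[x hx ->]|h].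
  by rewrite !mulrA mulVg // mul1r -mulrA mulVg // mulr1.
exists (invmx g * a * g) => //.
by rewrite !mulrA mulgV // mul1r -mulrA mulgV // mulr1.
Qed.

Lemma V_full g : unitm g -> is_full_order v (V g).
Proof.
move=> ug; have lat : is_lattice v (V g).
  apply: (@lattice_transport (mulmx g \o mulmxr (invmx g))
    (mulmx (invmx g) \o mulmxr g) M2O) (M2O_lattice) => a /=.
  - by rewrite !mulmxA mulmxV // mul1mx -mulmxA mulmxV // mulmx1.
  - by rewrite !mulmxA mulVmx // mul1mx -mulmxA mulVmx // mulmx1.
  - by rewrite mulmxA; apply: VP.
split; last by case: lat.
split; last by case: lat.
- by apply/VP => //; rewrite mulr1 mulVg //; apply: M2O1.
- by move=> a b /VP-/(_ ug) ha /VP-/(_ ug) hb; apply/VP => //;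
    rewrite mulrDr mulrDl; apply: M2OD.
- by move=> a /VP-/(_ ug) ha; apply/VP => //; rewrite mulrN mulNr; apply: M2ON.
- move=> a b /VP-/(_ ug) ha /VP-/(_ ug) hb; apply/VP => //.
  rewrite (_ : _ * g = invmx g * a * g * (invmx g * b * g)); first exact: M2OM.
  by rewrite !mulrA -(mulrA _ g) mulgV // mulr1.
Qed.

(** Half of the self-duality of $\mathbb M_2(\mathcal O_K)$ for the trace form: pairing with matrix
    units reads off the entries. *)
Lemma M2O_of_tr x : (forall m, M2O m -> iO (\tr (x * m))) -> M2O x.
Proof.
have [p [q [r [s ->]]]] := mkP x => key.
have O0 := iO0; have O1 := iO1; apply/M2OP; split.
- have := key (mk 1 0 0 0); rewrite mkM mktr !(mulr1, mulr0, addr0, add0r).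
  by apply; apply/M2OP.
- have := key (mk 0 0 1 0); rewrite mkM mktr !(mulr1, mulr0, addr0, add0r).
  by apply; apply/M2OP.
- have := key (mk 0 1 0 0); rewrite mkM mktr !(mulr1, mulr0, addr0, add0r).
  by apply; apply/M2OP.
- have := key (mk 0 0 0 1); rewrite mkM mktr !(mulr1, mulr0, addr0, add0r).
  by apply; apply/M2OP.
Qed.

(** Elements of a larger order have integral trace pairings with [V g], so self-duality puts them
    back in [V g]. *)
Lemma V_maximal g : unitm g -> maximal_order v (V g).
Proof.
move=> ug; split; first exact: (proj1 (V_full ug)).
move=> R' oR' sub a Ra; apply/VP => //.
have key m : M2O m -> iO (\tr (invmx g * a * g * m)).
  move=> hm; rewrite -!mulrA mxtrace_mulC -[_ *m _]/(_ * _) -!mulrA.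
  apply: (order_tr oR'); apply: (orderM oR') => //; apply: sub.
  by exists m => //; rewrite mulrA.
exact: M2O_of_tr key.
Qed.

Lemma invmx_mk (a b c d : K) : a * d - b * c != 0 ->
  invmx (mk a b c d) = (a * d - b * c)^-1 *: mk d (- b) (- c) a.
Proof.
move=> ne; apply: (proj2 (invmx_uniq _)).
by rewrite mkZ mkM mk1; congr mk; field; rewrite ?ne.
Qed.

(* The first columns of [R] form an [R]-stable lattice, and the columns of [g]
   are a basis of it. *)
Lemma full_order_sub_V R : is_full_order v R -> exists g, unitm g /\ subsetM R (V g).
Proof.
(* [f x y] is the determinant of the first columns of [x] and [y]. A pair in [R] minimizing its
   valuation gives the basis, and the four quotients [m1] to [m4] below are the entries of
   [invmx g * a * g] by Cramer's rule. *)
move=> [oR sR]; pose f x y : K :=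
  x ord0 ord0 * y ord_max ord0 - x ord_max ord0 * y ord0 ord0.
have fDl x x' y : f (x + x') y = f x y + f x' y by rewrite /f !mxE; ring.
have fZl k x y : f (k *: x) y = k * f x y by rewrite /f !mxE; ring.
have fC x y : f x y = - f y x by rewrite /f; ring.
have f0 y : f 0 y = 0 by rewrite /f !mxE !mul0r subrr.
have [N hN] : exists N, forall x, R x -> forall i j, vge N (x i j).
  by apply: fg_bounded; case: oR.
have bd (t : 'M[K]_2 * 'M[K]_2) : R t.1 /\ R t.2 -> vge (N + N) (f t.1 t.2).
  by move=> [R1 R2]; apply: vgeB; apply: vgeM; apply: hN.
have ne : exists t, (R t.1 /\ R t.2) /\ f t.1 t.2 != 0.
  apply: NNPP => none.
  have h0 x y : R x -> R y -> f x y = 0.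
    move=> Rx Ry; apply/eqP; apply: contraT => nz; case: none.
    by exists (x, y).
  have h1 x y : R y -> f x y = 0.
    move=> Ry; apply: (Kspans_ind (P := fun x => f x y = 0) sR)
      => [|x1 x2|k x1|x1 Rx] //.
    - by rewrite fDl => -> ->; rewrite addr0.
    - by rewrite fZl => ->; rewrite mulr0.
    - exact: h0.
  have h2 x y : f x y = 0.
    rewrite fC; apply/eqP; rewrite oppr_eq0; apply/eqP.
    apply: (Kspans_ind (P := fun y => f y x = 0) sR)
      => [|x1 x2|k x1|x1 Rx] //.
    - by rewrite fDl => -> ->; rewrite addr0.
    - by rewrite fZl => ->; rewrite mulr0.
    - by rewrite fC h1 ?oppr0.
  have := h2 (mk 1 0 0 0) (mk 0 0 1 0).
  by rewrite /f !mkE mulr1 mulr0 subr0 => /eqP; rewrite oner_eq0.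
have [[x y] [/= [Rx Ry] fxy minf]] := ex_min_val ne bd.
pose g := mk (x ord0 ord0) (y ord0 ord0) (x ord_max ord0) (y ord_max ord0).
have dg : \det g = f x y by rewrite /g mkdet /f; ring.
have ug : unitm g by apply: unitm_det; rewrite dg.
exists g; split=> // a Ra; apply/VP => //.
have m1 := minf (a * x, y); have m2 := minf (a * y, y).
have m3 := minf (x, a * x); have m4 := minf (x, a * y).
have Rax : R (a * x) by apply: (orderM oR).
have Ray : R (a * y) by apply: (orderM oR).
move: {m1 m2 m3 m4} (m1 (conj Rax Ry)) (m2 (conj Ray Ry)) (m3 (conj Rx Rax)) (m4 (conj Rx Ray)).
move: dg fxy; rewrite /g /f /=.
have [a1 [a2 [a3 [a4 ->]]]] := mkP a.
have [x1 [x2 [x3 [x4 ->]]]] := mkP x; have [y1 [y2 [y3 [y4 ->]]]] := mkP y.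
rewrite !mkM !mkE mkdet => dg fxy m1 m2 m3 m4.
rewrite invmx_mk ?dg // !(mkM, mkZ); apply/M2OP.
have E k l : k = l -> iO l -> iO k by move=> ->.
by split; [apply: E m1|apply: E m2|apply: E m3|apply: E m4]; field.
Qed.

Lemma sameset_sym R S : samesetM R S -> samesetM S R.
Proof. by move=> h a; rewrite h. Qed.
Lemma sameset_trans R S T : samesetM R S -> samesetM S T -> samesetM R T.
Proof. by move=> h h' a; rewrite h. Qed.

(** The matrix [z] is in $GL_2(\mathcal O_K)$, so [g] and [h] span homothetic lattices. *)
Lemma V_same g h z k : unitm g -> k != 0 -> M2O z -> \det z != 0 -> v (\det z) = 0 ->
  h = k *: (g * z) -> unitm h /\ samesetM (V h) (V g).
Proof.
move=> ug k0 Oz dz vz ->; have uz : unitm z by apply: unitm_det.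
have Ozi : M2O (invmx z).
  move: Oz dz vz; have [a [b [c [d ->]]]] := mkP z => /M2OP [? ? ? ?].
  rewrite mkdet => dz vz; rewrite invmx_mk //; apply: M2OZ.
    by right; rewrite vV // vz.
  by apply/M2OP; split=> //; apply: iON.
have [uh ih] : unitm (k *: (g * z)) /\ invmx (k *: (g * z)) = k^-1 *: (invmx z * invmx g).
  apply: invmx_uniq; rewrite -scalerAr -scalerAl scalerA mulVf // scale1r.
  by rewrite mulrA -(mulrA g) mulgV // mulr1 mulgV.
split=> // a; rewrite !VP // ih -scalerAl -scalerAl -scalerAr scalerA mulVf // scale1r.
rewrite (_ : _ * (g * z) = invmx z * (invmx g * a * g) * z); last by rewrite !mulrA.
split=> hz; last by apply: M2OM => //; apply: M2OM.
rewrite -[_ * g]mul1r -[_ * (_ * g)]mulr1 -(mulgV uz) !mulrA.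
have := M2OM Oz (M2OM hz Ozi); rewrite !mulrA.
by rewrite -[z * invmx z * _]mulrA.
Qed.

(** As [i] varies, [V (g * Dm i)] runs through the apartment defined by the columns of [g],
    consecutive indices giving neighbours. *)
Definition Dm (i : int) : 'M[K]_2 := mk 1 0 0 (pi ^ i).

Lemma det_Dm i : \det (Dm i) = pi ^ i. Proof. by rewrite mkdet; ring. Qed.
Lemma unitm_Dm i : unitm (Dm i).
Proof. by apply: unitm_det; rewrite det_Dm piz0. Qed.
Lemma DmM i j : Dm i * Dm j = Dm (i + j).
Proof. by rewrite mkM /Dm expfzDr //; congr mk; ring. Qed.
Lemma Dm0 : Dm 0 = 1. Proof. by rewrite /Dm expr0z mk1. Qed.
Lemma unitm_mulDm g i : unitm g -> unitm (g * Dm i).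
Proof. by move=> ug; apply: unitmM => //; apply: unitm_Dm. Qed.

(* Membership in [V (Dm i)]. *)
Definition hereditary i x := [/\ iO (x ord0 ord0), iO (x ord0 ord_max * pi ^ i),
  iO (x ord_max ord0 * pi ^ (- i)) & iO (x ord_max ord_max)].

Lemma VDP g i a : unitm g -> V (g * Dm i) a <-> hereditary i (invmx g * a * g).
Proof.
move=> ug; rewrite VP; last exact: unitm_mulDm.
rewrite invmM //; last exact: unitm_Dm.
rewrite (_ : _ * (g * _) = invmx (Dm i) * (invmx g * a * g) * Dm i); last by rewrite !mulrA.
have [p [q [r [s ->]]]] := mkP (invmx g * a * g).
rewrite /Dm invmx_mk; last by rewrite mul1r mul0r subr0 piz0.
rewrite mul1r mul0r subr0 mkZ !mkM /hereditary !mkE M2OP -invr_expz.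
have p0 := piz0 i.
have e1 : ((pi ^ i)^-1 * pi ^ i * p + (pi ^ i)^-1 * - 0 * r) * 1
   + ((pi ^ i)^-1 * pi ^ i * q + (pi ^ i)^-1 * - 0 * s) * 0 = p by field.
have e2 : ((pi ^ i)^-1 * pi ^ i * p + (pi ^ i)^-1 * - 0 * r) * 0
   + ((pi ^ i)^-1 * pi ^ i * q + (pi ^ i)^-1 * - 0 * s) * pi ^ i = q * pi ^ i by field.
have e3 : ((pi ^ i)^-1 * - 0 * p + (pi ^ i)^-1 * 1 * r) * 1
   + ((pi ^ i)^-1 * - 0 * q + (pi ^ i)^-1 * 1 * s) * 0 = r / pi ^ i by field.
have e4 : ((pi ^ i)^-1 * - 0 * p + (pi ^ i)^-1 * 1 * r) * 0
   + ((pi ^ i)^-1 * - 0 * q + (pi ^ i)^-1 * 1 * s) * pi ^ i = s by field.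
by rewrite e1 e2 e3 e4.
Qed.

Lemma BT_adjP R S : BT_adjacent v pi R S <->
  exists g, [/\ unitm g, samesetM R (V g) & samesetM S (V (g * Dm 1))].
Proof.
have E g : unitm g -> samesetM (conj_set g (Eichler_std v pi)) (V (g * Dm 1)).
  move=> ug a; rewrite VDP // /hereditary exprN1 expr1z.
  split=> [[x [? ? ? ?] ->]|[? ? ? ?]].
    by rewrite !mulrA mulVg // mul1r -mulrA mulVg // mulr1; split=> //; rewrite mulrC.
  exists (invmx g * a * g); first by split=> //; rewrite mulrC.
  by rewrite !mulrA mulgV // mul1r -mulrA mulgV // mulr1.
split=> [[g [ug [hR hS]]]|[g [ug hR hS]]]; exists g; split=> //.
  exact: sameset_trans hS (E g ug).
by split=> //; apply: sameset_trans hS (sameset_sym (E g ug)).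
Qed.

Lemma thicken_sub R S : subsetM R S -> subsetM (thicken R) (thicken S).
Proof. by move=> RS y [k [r [? /RS ? ->]]]; exists k, r. Qed.

(** Every neighbour of [V g] is [V (h * Dm 1)] for some [h] with [V h] equal to [V g], so $\mathcal
    O_K+\pi_K V$ lies in all neighbours of a vertex $V$. *)
Lemma thicken_V_sub g : unitm g -> subsetM (thicken (V g)) (V (g * Dm 1)).
Proof.
move=> ug y [k [r [kO /VP-/(_ ug) hr ->]]]; apply/VDP => //.
rewrite mulrDr mulrDl -!scalerAr -!scalerAl mulr1 mulVg //.
move: hr; have [a [b [c [d ->]]]] := mkP (invmx g * r * g) => /M2OP [? ? ? ?].
have piO := iO_pi.
rewrite mk1 !mkZ mkD /hereditary !mkE exprN1 expr1z !mulr1 !mulr0 !add0r.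
split.
- by apply: iOD => //; apply: iOM.
- by apply: iOM => //; apply: iOM.
- by rewrite mulrAC divff // mul1r.
- by apply: iOD => //; apply: iOM.
Qed.

Lemma thicken_order R : is_order v R -> is_order v (thicken R).
Proof.
move=> oR; have R0 : R 0 by rewrite -(subrr 1); apply: (orderB oR); apply: (order1 oR).
split.
- by exists 1, 0; split=> //; [apply: iO1|rewrite scale1r scaler0 addr0].
- move=> _ _ [k [r [kO Rr ->]]] [l [s [lO Rs ->]]]; exists (k + l), (r + s).
  split; [exact: iOD|exact: (orderD oR)|].
  by rewrite scalerDr scalerDl addrACA.
- move=> _ [k [r [kO Rr ->]]]; exists (- k), (- r).
  by split; [exact: iON|exact: (orderN oR)|rewrite opprD scaleNr scalerN].
- move=> _ _ [k [r [kO Rr ->]]] [l [s [lO Rs ->]]].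
  exists (k * l), (k *: s + l *: r + pi *: (r * s)); split; first exact: iOM.
    have piO := iO_pi; have Rrs : R (r * s) by apply: (orderM oR).
    by do 2?[apply: (orderD oR)]; apply: (orderZ oR).
  by mx2_split r; mx2_split s; mx2_ring.
have [_ _ _ _ [s hs]] := oR.
exists (1 :: map (fun x => pi *: x) s) => a.
have sE (c : nat -> K) : \sum_(i < size (1 :: map (fun x => pi *: x) s))
    c i *: (1 :: map (fun x => pi *: x) s)`_i
  = c 0%N *: 1 + pi *: \sum_(i < size s) c i.+1 *: s`_i.
  rewrite [size _]/= big_ord_recl /=; congr (_ + _).
  rewrite -(big_mkord xpredT (fun i => c i.+1 *: s`_i)) scaler_sumr.
  rewrite -(big_mkord xpredT (fun i => c i.+1 *: (map (fun x => pi *: x) s)`_i)).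
  rewrite size_map; apply: eq_big_nat => i /andP [_ ir].
  by rewrite (nth_map 0) // !scalerA mulrC.
split=> [[k [r [kO /hs [c [cO ->]] ->]]]|[c [cO ->]]].
  pose c' i := if i is i'.+1 then c i' else k.
  by exists c'; split; [case|rewrite sE].
rewrite sE; exists (c 0%N), (\sum_(i < size s) c i.+1 *: s`_i); split=> //.
by apply/hs; exists (fun i => c i.+1); split.
Qed.

(* Over the local ring [thicken (V g)] an invertible ideal is principal, hence
   cyclic modulo the radical; the codifferent needs two generators there. *)
Lemma thick_not_Gorenstein g : unitm g -> ~ Gorenstein v (thicken (V g)).
Proof.
move=> ug [fT [_ [J [[_ _ JT] [IJ JI]]]]]; set T := thicken (V g) in fT JT IJ JI.
have [oV _] := V_full ug; have oT : is_order v T by case: fT.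
(* Otherwise every product from the two ideals lies in [pi *: V g], and so does 1, which its
   determinant forbids. *)
have [x [y [cx Jy Txy]]] : exists x y,
    [/\ codifferent v T x, J y & exists k r, [/\ k != 0, v k = 0, V g r & x * y = k *: 1 + pi *: r]].
  apply: NNPP => none.
  have [s [sIJ E]] := proj2 (IJ 1) (order1 oT).
  have : exists r, V g r /\ \sum_(p <- s) p.1 * p.2 = pi *: r.
    rewrite big_seq; elim/big_ind: _ => //.
    - exists 0; rewrite scaler0; split=> //.
      by rewrite -(subrr 1); apply: (orderB oV); apply: (order1 oV).
    - move=> _ _ [r [Vr ->]] [r' [Vr' ->]]; exists (r + r').
      by rewrite scalerDr; split=> //; apply: (orderD oV).
    move=> p ps; have [Ip Jp] := sIJ p ps.
    have /IJ [k [r [kO Vr Er]]] : prodset (codifferent v T) J (p.1 * p.2).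
      by exists [:: p]; split=> [q|]; rewrite ?big_seq1 // inE => /eqP ->.
    have [[k0 vk]|k1] := iO_unitP kO.
      by case: none; exists p.1, p.2; split=> //; exists k, r.
    exists ((k / pi) *: 1 + r); split.
      by apply: (orderD oV) => //; apply: (order_scalar oV); apply: vge1_pi.
    by rewrite Er scalerDr scalerA mulrCA divff // mulr1.
  move=> [r [Vr]]; rewrite -E => /(congr1 determinant).
  rewrite det1 detZ => E1; apply: vge1_1; rewrite E1.
  have := vgeM (vgeM (vge_v pi) (vge_v pi)) (order_det oV Vr).
  by rewrite vpi addr0 -expr2; apply: vge_le.
have [k [r [k0 vk Vr E]]] := Txy.
have kO : iO k by right; rewrite vk.
pose t := k *: 1 + pi *: r; have Tt : T t by exists k, r.
have dtE : \det t = k * k + pi * (k * \tr r + pi * \det r).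
  by rewrite /t; mx2_split r; rewrite !mkEs; ring.
have dt1 : ~ vge 1 (\det t).
  rewrite dtE => h; have : vge 1 (k * k).
    rewrite -[k * k](addrK (pi * (k * \tr r + pi * \det r))); apply: vgeB => //.
    rewrite -[1]addr0 -{1}vpi; apply: vgeM; first exact: vge_v.
    apply: iOD; apply: iOM => //; [exact: (order_tr oV)|exact: iO_pi|exact: (order_det oV)].
  by move/vge_inv => /(_ (mulf_neq0 k0 k0)); rewrite vM // vk.
have [[d0 vd]|//] := iO_unitP (order_det oT Tt).
(* The inverse of [t] through its adjugate; it stays in [T] because [\det t] is congruent to the
   unit [k * k] modulo [pi]. *)
pose ti := (\det t)^-1 *: (\tr t *: 1 - t).
have tti : t * ti = 1.
  rewrite /ti -scalerAr mulrBr -scalerAr mulr1 cayley opprB addrC subrK.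
  by rewrite scalerA mulVf // scale1r.
have Tti : T ti.
  apply: (orderZ oT); first by right; rewrite vV // vd.
  by apply: (orderB oT) => //; apply: (order_scalar oT); apply: (order_tr oT).
(* After this normalization of [y], the element [x] generates the codifferent as a right ideal. *)
pose y' := y * ti; have Jy' : J y' by apply: JT.
have xy' : x * y' = 1 by rewrite /y' mulrA E.
have gen z : codifferent v T z -> exists l r', [/\ iO l, V g r' & z = x * (l *: 1 + pi *: r')].
  move=> cz; have /JI [l [r' [lO Vr' Er]]] : prodset J (codifferent v T) (y' * z).
    by exists [:: (y', z)]; split=> [q|]; rewrite ?big_seq1 // inE => /eqP ->.
  by exists l, r'; split=> //; rewrite -Er mulrA xy' mul1r.
pose X := pi *: (invmx g * x * g).
have OX : M2O X.
  apply: M2O_of_tr => m Om; rewrite /X -scalerAl scalerAr -!mulrA mxtrace_mulC.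
  rewrite -[_ *m _]/(_ * _) -!mulrA; apply: cx.
  exists 0, (g * m * invmx g); split; [exact: iO0|by exists m|].
  by rewrite scale0r add0r -scalerAl -scalerAr mulrA.
have cE m : M2O m -> \tr m = 0 -> codifferent v T (pi^-1 *: (g * m * invmx g)).
  move=> Om tm _ [l [r' [lO /VP-/(_ ug) Or ->]]].
  rewrite -scalerAl mulrDr -!scalerAr mulr1 scalerDr !scalerA mulVf // scale1r.
  rewrite mxtraceD mxtraceZ -[\tr (g * m * _)](mxtrace_conj _ ug).
  rewrite !mulrA mulVg // mul1r -mulrA mulVg // mulr1 tm mulr0 add0r.
  rewrite -[\tr _](mxtrace_conj _ ug) !mulrA mulVg // mul1r -!mulrA.
  have := M2OM Om Or; rewrite -!mulrA.
  move: (_ * _) => w; have [a [b [c [d ->]]]] := mkP w => /M2OP [? ? ? ?].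
  by rewrite mktr; apply: iOD.
(* Modulo [pi], the single matrix [X] would span all traceless matrices; two off-diagonal matrix
   units refute this. *)
have eqn m : M2O m -> \tr m = 0 -> exists l r', [/\ iO l, M2O r' & m = l *: X + pi *: r'].
  move=> Om tm; have [l [r' [lO /VP-/(_ ug) Or Er]]] := gen _ (cE m Om tm).
  exists l, (X * (invmx g * r' * g)); split=> //; first exact: M2OM.
  have -> : m = pi *: (invmx g * (pi^-1 *: (g * m * invmx g)) * g).
    rewrite -scalerAr -scalerAl scalerA divff // scale1r.
    by rewrite !mulrA mulVg // mul1r -mulrA mulVg // mulr1.
  rewrite Er /X mulrDr -!scalerAr mulr1 mulrDr mulrDl scalerDr -!scalerAr -!scalerAl.
  rewrite !scalerA [pi * l]mulrC; congr (_ + _ *: _).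
  by rewrite !mulrA -(mulrA _ g) mulgV // mulr1.
have O0 := iO0; have O1 := iO1.
have [||l [r1 [lO Or1 E1]]] := eqn (mk 0 1 0 0); [by apply/M2OP|by rewrite mktr addr0|].
have [||m [r2 [mO Or2 E2]]] := eqn (mk 0 0 1 0); [by apply/M2OP|by rewrite mktr addr0|].
move: OX E1 E2 Or1 Or2; have [a [b [c [d ->]]]] := mkP X.
have [a1 [b1 [c1 [d1 ->]]]] := mkP r1; have [a2 [b2 [c2 [d2 ->]]]] := mkP r2.
move=> /M2OP [? bO cO ?]; rewrite !mkZ !mkD => E1 E2 /M2OP [? b1O ? ?] /M2OP [? b2O c2O ?].
have F1 : 1 = l * b + pi * b1 by rewrite -[LHS](mk01 0 1 0 0) E1 mk01.
have F2 : 0 = m * b + pi * b2 by rewrite -[LHS](mk01 0 0 1 0) E2 mk01.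
have F3 : 1 = m * c + pi * c2 by rewrite -[LHS](mk10 0 0 1 0) E2 mk10.
apply: vge1_1.
(* Modulo [pi], [l * b] and [m * c] are 1 while [m * b] is 0, yet $(lb)(mc)=(mb)(lc)$. *)
have -> : 1 = pi * (b1 + l * b * c2 - b2 * (l * c)).
  transitivity (l * b * (m * c + pi * c2) + pi * b1); first by rewrite -F3 mulr1.
  have F2' : m * b = - (pi * b2) by apply/eqP; rewrite -addr_eq0 -F2.
  rewrite (_ : l * b * (m * c + pi * c2) = m * b * (l * c) + l * b * pi * c2); last ring.
  by rewrite F2'; ring.
rewrite -[1]addr0 -{1}vpi; apply: vgeM; first exact: vge_v.
by apply: iOB; [apply: iOD => //; do 2?apply: iOM|do 2?apply: iOM].
Qed.

(** * Lines and Bass orders *)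

Lemma conj_V g z x : unitm g -> unitm z ->
  V (g * z) (g * x * invmx g) <-> M2O (invmx z * x * z).
Proof.
move=> ug uz; rewrite VP; last exact: unitmM.
by rewrite invmM // !mulrA -!(mulrA _ (invmx g) g) mulVg // !mulr1.
Qed.

Lemma vge_not_iO N k : k != 0 -> v k < 0 -> ~ iO k.
Proof. by move=> k0 vk /vge_inv -/(_ k0); rewrite leNgt vk. Qed.

Lemma line_Bass H : is_full_order v H -> is_line v pi (branch v H) -> Bass v H.
Proof.
move=> fH [I [f [_ _ [fS Sf] finj fadj]]]; split=> // R oR HR.
have fR : is_full_order v R by split=> //; apply: Kspans_mono HR _; case: fH.
have [//|[R' [fR' RR']]] := Gorenstein_or_thick fR.
have [g [ug R'V]] := full_order_sub_V fR'.
have HT a : H a -> thicken (V g) a by move=> /HR /RR'; apply: thicken_sub.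
have O0 := iO0; have O1 := iO1; have Om := iON iO1.
have nbr z : M2O z -> \det z != 0 -> v (\det z) = 0 -> exists i,
    [/\ I i, samesetM (f i) (V (g * z * Dm 1))
      & forall i0, I i0 -> samesetM (f i0) (V g) -> `|i0 - i| = 1].
  move=> Oz dz vz.
  have [uh hE] := @V_same g (g * z) z 1 ug (oner_neq0 _) Oz dz vz (esym (scale1r _)).
  have HS : branch v H (V (g * z * Dm 1)).
    split; first by apply: V_maximal; apply: unitm_mulDm.
    move=> a /HT ha; apply: thicken_V_sub => //.
    by apply: thicken_sub ha => b; apply: (proj2 (hE b)).
  have [i [Ii fi]] := Sf _ HS; exists i; split=> // i0 Ii0 fi0.
  apply/(fadj i0 i Ii0 Ii)/BT_adjP; exists (g * z); split=> //.
  exact: sameset_trans fi0 (sameset_sym hE).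
have [i0 [Ii0 fi0]] : exists i, I i /\ samesetM (f i) (V g).
  apply: Sf; split; first exact: V_maximal.
  move=> a /HT [k [r [kO Vr ->]]]; have [oV _] := V_full ug.
  apply: (orderD oV); first exact: (order_scalar oV).
  by apply: (orderZ oV) => //; apply: iO_pi.
(* Neighbours of [V g] correspond to lines in the residue plane, here spanned by the first column of
   [z]. The three choices (1,0), (0,1), (1,1) are distinct over every residue field. *)
have [|||i1 [Ii1 fi1 a1]] := nbr (mk 1 0 0 1).
- by apply/M2OP.
- by rewrite mkdet mulr1 mulr0 subr0 oner_neq0.
- by rewrite mkdet mulr1 mulr0 subr0 v1.
have [|||i2 [Ii2 fi2 a2]] := nbr (mk 0 1 1 0).
- by apply/M2OP.
- by rewrite mkdet mulr1 mulr0 sub0r oppr_eq0 oner_neq0.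
- by rewrite mkdet mulr1 mulr0 sub0r vN v1.
have [|||i3 [Ii3 fi3 a3]] := nbr (mk 1 0 1 1).
- by apply/M2OP.
- by rewrite mkdet mulr1 mul0r subr0 oner_neq0.
- by rewrite mkdet mulr1 mul0r subr0 v1.
move: (a1 _ Ii0 fi0) (a2 _ Ii0 fi0) (a3 _ Ii0 fi0) => {}a1 {}a2 {}a3.
have dt (z : 'M[K]_2) : \det z != 0 -> unitm (z * Dm 1).
  by move=> dz; apply: unitmM (unitm_det dz) (unitm_Dm _).
(* Two neighbours are told apart by a matrix [x] that lies, after conjugation by [g], in exactly one
   of them. *)
have dist (z1 z2 x : 'M[K]_2) i j : unitm (z1 * Dm 1) -> unitm (z2 * Dm 1) ->
   samesetM (f i) (V (g * z1 * Dm 1)) -> samesetM (f j) (V (g * z2 * Dm 1)) ->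
   M2O (invmx (z1 * Dm 1) * x * (z1 * Dm 1)) ->
   ~ M2O (invmx (z2 * Dm 1) * x * (z2 * Dm 1)) -> i <> j.
  move=> u1 u2 h1 h2 y1 y2 ij; apply: y2; apply/(conj_V _ ug u2).
  by rewrite mulrA; apply/h2; rewrite -ij; apply/h1; rewrite -mulrA; apply/conj_V.
have p1 : ~ iO pi^-1 by apply: vge_not_iO; rewrite ?invr_eq0 // vV // vpi.
have p2 : ~ iO (pi^-1 * pi^-1).
  by apply: vge_not_iO; rewrite ?mulf_neq0 ?invr_eq0 // vM ?invr_eq0 // vV // vpi.
have zD : [/\ mk 1 0 0 1 * Dm 1 = mk 1 0 0 pi, mk 0 1 1 0 * Dm 1 = mk 0 pi 1 0
            & mk 1 0 1 1 * Dm 1 = mk 1 0 1 pi].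
  by split; rewrite /Dm mkM expr1z; congr mk; ring.
have [z1 z2 z3] := zD.
have u1 : unitm (mk 1 0 0 pi) by apply: unitm_det; rewrite mkdet mul1r mul0r subr0.
have u2 : unitm (mk 0 pi 1 0) by apply: unitm_det; rewrite mkdet mul0r mulr1 sub0r oppr_eq0.
have u3 : unitm (mk 1 0 1 pi) by apply: unitm_det; rewrite mkdet mul1r mul0r subr0.
have inv1 : invmx (mk 1 0 0 pi) = mk 1 0 0 pi^-1.
  by apply: (proj2 (invmx_uniq _)); rewrite mkM mk1; congr mk; field.
have inv2 : invmx (mk 0 pi 1 0) = mk 0 1 pi^-1 0.
  by apply: (proj2 (invmx_uniq _)); rewrite mkM mk1; congr mk; field.
have inv3 : invmx (mk 1 0 1 pi) = mk 1 0 (- pi^-1) pi^-1.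
  by apply: (proj2 (invmx_uniq _)); rewrite mkM mk1; congr mk; field.
have n12 : i1 <> i2.
  apply: (dist _ _ (mk 0 pi^-1 0 0) _ _ _ _ fi1 fi2); rewrite ?z1 ?z2 ?inv1 ?inv2 //.
    by rewrite !mkM; apply/M2OP; rewrite !(mul0r, mulr0, mul1r, mulr1, add0r, addr0) mulVf.
  by rewrite !mkM => /M2OP [_ _ + _]; rewrite !(mul0r, mulr0, mul1r, mulr1, add0r, addr0).
have n13 : i1 <> i3.
  apply: (dist _ _ (mk 0 pi^-1 0 0) _ _ _ _ fi1 fi3); rewrite ?z1 ?z3 ?inv1 ?inv3 //.
    by rewrite !mkM; apply/M2OP; rewrite !(mul0r, mulr0, mul1r, mulr1, add0r, addr0) mulVf.
  by rewrite !mkM => /M2OP [+ _ _ _]; rewrite !(mul0r, mulr0, mul1r, mulr1, add0r, addr0).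
have n23 : i2 <> i3.
  apply: (dist _ _ (mk 0 0 pi^-1 0) _ _ _ _ fi2 fi3); rewrite ?z2 ?z3 ?inv2 ?inv3 //.
    by rewrite !mkM; apply/M2OP; rewrite !(mul0r, mulr0, mul1r, mulr1, add0r, addr0) mulVf.
  by rewrite !mkM => /M2OP [_ _ + _]; rewrite !(mul0r, mulr0, mul1r, mulr1, add0r, addr0).
(* Only two integers are at distance 1 from [i0]. *)
lia.
Qed.

Lemma hereditary_mk i a b c d : hereditary i (mk a b c d) <->
  [/\ iO a, iO (b * pi ^ i), iO (c * pi ^ (- i)) & iO d].
Proof. by rewrite /hereditary !mkE. Qed.

Lemma iO_shift N k : vge N k <-> iO (k * pi ^ (- N)).
Proof.
split=> [h|h].
  by have := vgeM h (vge_pi (- N)); rewrite subrr.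
have := vgeM h (vge_pi N); rewrite add0r -mulrA -expfzDr // addNr expr0z mulr1.
exact.
Qed.

Lemma hereditaryP i a b c d : hereditary i (mk a b c d) <->
  [/\ iO a, vge (- i) b, vge i c & iO d].
Proof.
have [b1 b2] := iO_shift (- i) b; have [c1 c2] := iO_shift i c.
rewrite hereditary_mk; rewrite opprK in b1 b2.
by split=> -[? ? ? ?]; split; auto.
Qed.

Lemma VDmP g i y : unitm g -> V (g * Dm i) (g * y * invmx g) <-> hereditary i y.
Proof.
by move=> ug; rewrite VDP // !mulrA -!(mulrA _ (invmx g) g) mulVg // mul1r mulr1.
Qed.

(** The extreme off-diagonal elements, with entries [pi ^ (- i)] and [pi ^ i], bound the two signed
    differences. The case [e = 0] separates vertices, and [e = 1] bounds the distance of
    neighbours. *)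
Lemma VDm_dist g i j (e : int) : unitm g ->
  (forall a, V (g * Dm i) a -> V (g * Dm j) (pi ^ e *: a)) -> `|i - j| <= e.
Proof.
move=> ug h; have O0 := iO0.
have sc y : hereditary i y -> hereditary j (pi ^ e *: y).
  by move=> /(VDmP _ _ ug) /h; rewrite scalerAl scalerAr => /(VDmP _ _ ug).
have piE (n m : int) : vge n (pi ^ m) -> n <= m.
  by move/vge_inv => /(_ (piz0 _)); rewrite vXz.
have h1 : hereditary i (mk 0 (pi ^ (- i)) 0 0).
  by apply/hereditaryP; split=> //; [apply: vge_pi|apply: vge0].
have h2 : hereditary i (mk 0 0 (pi ^ i) 0).
  by apply/hereditaryP; split=> //; [apply: vge0|apply: vge_pi].
have := sc _ h1; rewrite mkZ => /hereditaryP [_ + _ _]; rewrite -expfzDr // => /piE.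
have := sc _ h2; rewrite mkZ => /hereditaryP [_ _ + _]; rewrite -expfzDr // => /piE.
lia.
Qed.

Lemma VDm_inj g i j : unitm g ->
  samesetM (V (g * Dm i)) (V (g * Dm j)) -> i = j.
Proof.
move=> ug E; have : `|i - j| <= 0.
  by apply: (VDm_dist ug) => a /E; rewrite expr0z scale1r.
lia.
Qed.

Lemma VDm_adj g i j : unitm g ->
  BT_adjacent v pi (V (g * Dm i)) (V (g * Dm j)) <-> `|i - j| = 1.
Proof.
move=> ug; split.
  move=> /BT_adjP [h [uh E1 E2]].
  have le1 : `|i - j| <= 1.
    apply: (VDm_dist ug) => a /E1 ha; apply/E2; apply: thicken_V_sub => //.
    by exists 0, a; split=> //; [apply: iO0|rewrite scale0r add0r expr1z].
  have ne : i <> j.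
    move=> ij; have : 0 = 1 :> int; last by [].
    apply: (@VDm_inj h) => //; rewrite Dm0 mulr1.
    by apply: sameset_trans (sameset_sym E1) _; rewrite ij.
  lia.
move=> ij; have [->|->] : j = i + 1 \/ j = i - 1 by lia.
  apply/BT_adjP; exists (g * Dm i); split=> //; first exact: unitm_mulDm.
  by rewrite -mulrA DmM.
(* The swap [w] reverses the apartment, so a step from [i] to [i - 1] takes the standard form up to
   the scalar [pi]. *)
have O0 := iO0; have O1 := iO1; pose w : 'M[K]_2 := mk 0 1 1 0.
have Ow : M2O w by apply/M2OP.
have dw : \det w = - 1 by rewrite mkdet mul0r mulr1 sub0r.
have dw0 : \det w != 0 by rewrite dw oppr_eq0 oner_neq0.
have vw : v (\det w) = 0 by rewrite dw vN v1.
have [u1 E1] := V_same (unitm_mulDm i ug) (oner_neq0 K) Ow dw0 vw (esym (scale1r _)).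
have [] := @V_same (g * Dm (i - 1)) (g * Dm i * w * Dm 1) w pi
  (unitm_mulDm _ ug) pi0 Ow dw0 vw.
  rewrite -!mulrA scalerAr; congr (_ * _).
  by rewrite /Dm /w !mkM mkZ expr1z expfzDr // exprN1; congr mk; field.
by move=> _ E2; apply/BT_adjP; exists (g * Dm i * w); split=> //; apply: sameset_sym.
Qed.

(** Iwasawa decomposition: column operations over the valuation ring and a scaling, neither of which
    changes [V h]. The bottom entry of smaller valuation clears the other one. *)
Lemma upper_triangular_form h : unitm h -> exists q m z k,
  [/\ M2O z, \det z != 0, v (\det z) = 0, k != 0 & mk 1 q 0 (pi ^ m) = k *: (h * z)].
Proof.
have O0 := iO0; have O1 := iO1.
have tri p q s : p != 0 -> s != 0 -> exists q' m z k, [/\ M2O z, \det z != 0,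
    v (\det z) = 0, k != 0 & mk 1 q' 0 (pi ^ m) = k *: (mk p q 0 s * z)].
  move=> p0 s0; pose m := v (s / p); pose u := s / p * pi ^ (- m).
  have u0 : u != 0 by rewrite !mulf_neq0 ?invr_eq0 // piz0.
  have vu : v u = 0 by rewrite vM ?mulf_neq0 ?invr_eq0 ?piz0 // vXz /m subrr.
  exists (q / u / p), m, (mk 1 0 0 u^-1), p^-1; split.
  - by apply/M2OP; split=> //; right; rewrite vV // vu.
  - by rewrite mkdet mul1r mul0r subr0 invr_eq0.
  - by rewrite mkdet mul1r mul0r subr0 vV // vu.
  - by rewrite invr_eq0.
  have pm0 := piz0 m.
  by rewrite mkM mkZ /u -invr_expz; congr mk; field; rewrite ?p0 ?s0 ?pm0.
have step (w : 'M[K]_2) p q s : M2O w -> \det w != 0 -> v (\det w) = 0 ->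
    p * s != 0 -> h * w = mk p q 0 s -> exists q m z k,
  [/\ M2O z, \det z != 0, v (\det z) = 0, k != 0 & mk 1 q 0 (pi ^ m) = k *: (h * z)].
  move=> Ow dw vw; rewrite mulf_eq0 negb_or => /andP [p0 s0] E.
  have [q' [m [z [k [Oz dz vz k0 E']]]]] := tri p q s p0 s0.
  have dE : \det (w * z) = \det w * \det z by apply: det_mulmx.
  exists q', m, (w * z), k; split=> //; first exact: M2OM.
  - by rewrite dE mulf_neq0.
  - by rewrite dE vM // vw vz.
  - by rewrite E' mulrA E.
move=> /det_unitm; move: step; have [p [q [r [s ->]]]] := mkP h.
rewrite mkdet => step dh.
have [r0|r0] := eqVneq r 0.
  apply: (step 1 p q s); first exact: M2O1.
  - by rewrite det1 oner_neq0.
  - by rewrite det1 v1.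
  - by move: dh; rewrite r0 mulr0 subr0.
  - by rewrite mulr1 r0.
have [/andP [s0 lsr]|sr] := boolP ((s != 0) && (v s <= v r)).
  have tO : iO (r / s) by apply: iO_div => //; right.
  apply: (step (mk 1 0 (- (r / s)) 1) (p - q * (r / s)) q s).
  - by apply/M2OP; split=> //; apply: iON.
  - by rewrite mkdet mulr1 mul0r subr0 oner_neq0.
  - by rewrite mkdet mulr1 mul0r subr0 v1.
  - by rewrite (_ : _ * s = p * s - q * r) //; field.
  - by rewrite mkM; congr mk; field.
have tO : iO (s / r).
  apply: iO_div => //; move: sr; rewrite negb_and negbK => /orP [/eqP ->|h'].
    exact: vge0.
  by right; lia.
apply: (step (mk (- (s / r)) 1 1 0) (q - p * (s / r)) p r).
- by apply/M2OP; split=> //; apply: iON.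
- by rewrite mkdet mulr0 mulr1 sub0r oppr_eq0 oner_neq0.
- by rewrite mkdet mulr0 mulr1 sub0r vN v1.
- by rewrite (_ : _ * r = - (p * s - q * r)) ?oppr_eq0 //; field.
- by rewrite mkM; congr mk; field.
Qed.

(** * Paths with both ends in a branch *)

Section Segments.
Variables (H : mxset K) (fH : is_full_order v H).

(** A path in an apartment is encoded by its two ends; convexity supplies the vertices between
    them. *)
Definition segment g (n : int) :=
  [/\ unitm g, subsetM H (V g) & subsetM H (V (g * Dm n))].

(** In the basis [g], the condition on the upper right entry is strongest at index 0 and the one on
    the lower left entry at index [n]. *)
Lemma segment_sub g n i : segment g n -> 0 <= i -> i <= n ->
  subsetM H (V (g * Dm i)).
Proof.
move=> [ug h0 hn] i0 iln a Ha; apply/VDP => //.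
move: (h0 a Ha) (hn a Ha) => /VP-/(_ ug) + /VDP-/(_ ug).
have [p [q [r [s ->]]]] := mkP (invmx g * a * g).
move=> /M2OP [? qO ? ?] /hereditaryP [? ? rn ?]; apply/hereditaryP; split=> //.
  by apply: vge_le qO; lia.
exact: vge_le rn.
Qed.

(** In the basis [g], lower left entries of [H] are divisible by [pi ^ n], and each term of [trip]
    contains one. As [trip] is invariant under conjugation, its valuation on a fixed triple bounds
    [n] for every [g]. *)
Lemma segment_bounded : exists B : int, forall g n, segment g n -> n <= B.
Proof.
have [e1 [e2 [e3 [H1 H2 H3 ne]]]] := Kspans_trip (proj2 fH).
exists (v (trip e1 e2 e3)) => g n [ug h0 hn]; apply: vge_inv ne.
have -> : trip e1 e2 e3 =
    trip (invmx g * e1 * g) (invmx g * e2 * g) (invmx g * e3 * g).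
  rewrite /trip -[LHS](mxtrace_conj _ ug); congr (\tr _).
  rewrite /comm !mulrBr !mulrBl !mulrA.
  by rewrite -!(mulrA _ g (invmx g)) mulgV // !mulr1.
have key a : H a -> exists p q r s, [/\ invmx g * a * g = mk p q r s,
    iO p, iO q, vge n r & iO s].
  move=> Ha; move: (h0 a Ha) (hn a Ha) => /VP-/(_ ug) + /VDP-/(_ ug).
  have [p [q [r [s ->]]]] := mkP (invmx g * a * g).
  by move=> /M2OP [? ? ? ?] /hereditaryP [? ? ? ?]; exists p, q, r, s.
have [p1 [q1 [r1 [s1 [-> ? ? ? ?]]]]] := key _ H1.
have [p2 [q2 [r2 [s2 [-> ? ? ? ?]]]]] := key _ H2.
have [p3 [q3 [r3 [s3 [-> ? ? ? ?]]]]] := key _ H3.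
have -> : trip (mk p1 q1 r1 s1) (mk p2 q2 r2 s2) (mk p3 q3 r3 s3) =
  ((p1 - s1) * q2 - q1 * (p2 - s2)) * r3
  + (q1 * (p3 - s3) - (p1 - s1) * q3) * r2 + ((p2 - s2) * q3 - q2 * (p3 - s3)) * r1.
  by rewrite /trip /comm !mkEs; ring.
rewrite -[n]add0r; do 2?apply: vgeD; apply: vgeM => //;
  by apply: iOB; apply: iOM => //; apply: iOB.
Qed.

Lemma segment_max : exists g n, [/\ 0 <= n, segment g n
  & forall g' n', segment g' n' -> n' <= n].
Proof.
have [B hB] := segment_bounded.
have [g0 [ug0 h0]] := full_order_sub_V fH.
have s0 : segment g0 0 by split; rewrite ?Dm0 ?mulr1.
have B0 := hB _ _ s0.
have [|m [[g [n [n0 sg E]]] minm]] := @ex_min_nat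
    (fun m => exists g n, [/\ 0 <= n, segment g n & n + m%:Z = B]).
  by exists `|B|%N, g0, 0; split=> //; lia.
exists g, n; split=> // g' n' sg'; rewrite leNgt; apply/negP => lt.
have le := hB _ _ sg'.
have : (m <= `|B - n'|)%N by apply: minm; exists g', n'; split=> //; lia.
lia.
Qed.

End Segments.

(** * Vertices of the branch relative to a longest path *)

Section Maximal.
Variables (H : mxset K) (fH : is_full_order v H).
Hypothesis Hthin : forall g, unitm g -> ~ subsetM H (thicken (V g)).
Variables (g : 'M[K]_2) (n : int) (n0 : 0 <= n) (sg : segment H g n).
Hypothesis maxn : forall g' n', segment H g' n' -> n' <= n.

(** Triangular representatives of vertices relative to [g]. For integral [q] the vertex is
    [V (g * Dm m)]; otherwise it leaves the apartment at index [m - v q], at distance [- v q]. *)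
Let T q m : 'M[K]_2 := mk 1 q 0 (pi ^ m).

Let unitT q m : unitm (T q m).
Proof. by apply: unitm_det; rewrite mkdet mul1r mulr0 subr0 piz0. Qed.

(* Otherwise the path from [V (g * T q m)] to [V (g * Dm n)] is too long. *)
Lemma no_left_branch q m : m <= n -> vge (m - n) q ->
  subsetM H (V (g * T q m)) -> 0 <= m.
Proof.
move=> mn hq hT; have [ug h0 hn] := sg; have O0 := iO0; have O1 := iO1.
suff /maxn : segment H (g * T q m) (n - m) by lia.
split=> //; first exact: unitmM.
(* A unipotent matrix, integral by the bound on [q], shows that the path starting at [V (g * T q m)]
   ends at the same vertex as the longest one. *)
have [||||_ E] := @V_same (g * Dm n) (g * T q m * Dm (n - m))
    (mk 1 (q * pi ^ (n - m)) 0 1) 1 (unitm_mulDm _ ug) (oner_neq0 _).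
- apply/M2OP; split=> //; have := vgeM hq (vge_pi (n - m)).
  by rewrite (_ : m - n + (n - m) = 0) //; lia.
- by rewrite mkdet mulr1 mulr0 subr0 oner_neq0.
- by rewrite mkdet mulr1 mulr0 subr0 v1.
- rewrite scale1r -!mulrA; congr (_ * _); rewrite /T /Dm !mkM.
  have -> : pi ^ n = pi ^ m * pi ^ (n - m) by rewrite -expfzDr //; congr (_ ^ _); lia.
  by congr mk; ring.
by move=> a /hn Ha; apply/E.
Qed.

(* Otherwise the path from that vertex to [V g] is too long: the vertex leaves
   the apartment of [g] at [V (g * Dm (m + k))], at distance [k]. *)
Lemma no_right_branch u (m k : int) : u != 0 -> v u = 0 -> 0 < k -> n <= m + k ->
  ~ subsetM H (V (g * T (u * pi ^ (- k)) m)).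
Proof.
move=> u0 vu k0 nmk hT; have [ug h0 hn] := sg; have O0 := iO0; have O1 := iO1.
have uO : iO u by right; rewrite vu.
have jO : iO (pi ^ (m + k)) by apply: iO_piz; lia.
(* Changing basis by [g'] fixes [V g] and gives an apartment through the given vertex. Its index
   there is [m + k + k]: [m + k] steps along the old apartment and [k] away from it. *)
pose g' : 'M[K]_2 := mk u 0 (pi ^ (m + k)) 1.
have dg' : \det g' = u by rewrite mkdet mulr1 mul0r subr0.
have [||||ug' E'] := @V_same g (g * g') g' 1 ug (oner_neq0 _).
- by apply/M2OP.
- by rewrite dg'.
- by rewrite dg'.
- by rewrite scale1r.
have [||||_ E] := @V_same (g * T (u * pi ^ (- k)) m) (g * g' * Dm (m + k + k))
    (mk 0 (- u) 1 (pi ^ k)) (pi ^ k) (unitmM ug (unitT _ _)) (piz0 _).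
- by apply/M2OP; split=> //; [apply: iON|apply: iO_piz; lia].
- by rewrite mkdet mul0r mulr1 sub0r opprK.
- by rewrite mkdet mul0r mulr1 sub0r opprK.
- rewrite -!mulrA scalerAr; congr (_ * _); rewrite /T /g' /Dm !mkM mkZ.
  have pk := piz0 k; rewrite !expfzDr // -invr_expz.
  by congr mk; field.
suff /maxn : segment H (g * g') (m + k + k) by lia.
split=> // a Ha; first by apply/E'/h0.
by apply/E/hT.
Qed.

(** In the basis [g * Dm (m + k)], both ends of the path make the off-diagonal entries of [H]
    divisible by [pi], and the branching vertex makes the diagonal entries congruent: [H] would lie
    in a thickened vertex. *)
Lemma no_inner_branch u (m k : int) : u != 0 -> v u = 0 -> 0 < k ->
  0 < m + k -> m + k < n -> ~ subsetM H (V (g * T (u * pi ^ (- k)) m)).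
Proof.
move=> u0 vu k0 j0 jn hT; have [ug h0 hn] := sg.
set j := m + k in j0 jn; have uO : iO u by right; rewrite vu.
apply: (Hthin (unitm_mulDm j ug)) => a Ha.
move: (h0 a Ha) (hn a Ha) (hT a Ha).
move=> /VP-/(_ ug) + /VDP-/(_ ug) + /VP-/(_ (unitmM ug (unitT _ _))).
rewrite (invmM ug (unitT _ _)).
rewrite (_ : _ * (g * _) = invmx (T (u * pi ^ (- k)) m) * (invmx g * a * g) * T (u * pi ^ (- k)) m);
  last by rewrite !mulrA.
have aE : a = g * (invmx g * a * g) * invmx g.
  by rewrite !mulrA mulgV // mul1r -mulrA mulgV // mulr1.
move: aE; have [p [q [r [s ->]]]] := mkP (invmx g * a * g) => aE.
move=> /M2OP [pO qO rO sO] /hereditaryP [_ _ rn _].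
have pk := piz0 k; have pj := piz0 j.
have -> : T (u * pi ^ (- k)) m = mk 1 (u / pi ^ k) 0 (pi ^ j / pi ^ k).
  by rewrite /T -invr_expz; congr mk; rewrite /j expfzDr // mulfK.
rewrite invmx_mk; last by rewrite mul1r mulr0 subr0 mulf_neq0 ?invr_eq0.
rewrite mkZ !mkM => /M2OP [_ + _ _]; set E := (X in iO X) => EO.
(* [E] is the upper right entry in the triangular basis; solving for [p - s] leaves only terms
   divisible by [pi]. *)
have psE : u * (p - s) = pi ^ k * E - q * pi ^ j + u * u * (r / pi ^ j).
  by rewrite /E; field; rewrite pk pj.
have rj : vge 1 (r / pi ^ j).
  by apply: (vge_le (N := 1)) (vgeM rn (vge_v _)); rewrite ?vV ?invr_eq0 // vXz; lia.
have qj : vge 1 (q * pi ^ j).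
  by apply: (vge_le (N := 1)) (vgeM qO (vge_pi j)); lia.
have psO : vge 1 (p - s).
  have -> : p - s = u^-1 * (u * (p - s)) by rewrite mulKf.
  rewrite psE -[1]add0r; apply: vgeM; first by right; rewrite vV // vu.
  apply: vgeD; first apply: vgeB => //.
    by apply: (vge_le (N := 1)) (vgeM (vge_pi k) EO); lia.
  by rewrite -[1]add0r; apply: vgeM => //; apply: iOM.
pose r0 := mk ((p - s) / pi) (q * pi ^ j / pi) (r / pi ^ j / pi) 0.
exists s, (g * Dm j * r0 * invmx (g * Dm j)); split=> //.
  by exists r0 => //; apply/M2OP; split; try exact: vge1_pi; apply: iO0.
have gj := unitm_mulDm j ug.
rewrite {1}aE invmM //; last exact: unitm_Dm.
have -> : mk p q r s = s *: 1 + pi *: (Dm j * r0 * invmx (Dm j)).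
  rewrite /Dm invmx_mk; last by rewrite mul1r mul0r subr0.
  by rewrite /r0 !mkEs; congr mk; field; rewrite ?pj.
by rewrite mulrDr mulrDl -!scalerAr -!scalerAl mulr1 mulgV // !mulrA.
Qed.

(** Being maximal, [R] equals some [V h], put in triangular form relative to [g]. If [q] is integral
    the vertex is on the apartment; otherwise the cases are a branching index before, beyond or
    strictly inside the path. *)
Lemma branch_on_segment R : branch v H R ->
  exists i, (0 <= i <= n) /\ samesetM (V (g * Dm i)) R.
Proof.
move=> [[oR maxR] HR]; have [ug h0 hn] := sg.
have fR : is_full_order v R by split=> //; apply: Kspans_mono HR (proj2 fH).
have [h [uh RV]] := full_order_sub_V fR.
have VR : samesetM (V h) R.
  move=> a; split; last exact: RV.
  exact: (maxR _ (proj1 (V_full uh)) RV).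
have uig : unitm (invmx g) by rewrite unitmx_inv.
have [q [m [z [k [Oz dz vz k0 E]]]]] := upper_triangular_form (unitmM uig uh).
have [uT E1] : unitm (g * T q m) /\ samesetM (V (g * T q m)) (V h).
  apply: (V_same uh k0 Oz dz vz).
  by rewrite /T E -scalerAr !mulrA mulgV // mul1r.
have HT : subsetM H (V (g * T q m)) by move=> a /HR /VR /E1.
have O0 := iO0; have O1 := iO1.
have [qO|[q0 vq]] : iO q \/ q != 0 /\ v q < 0.
  have [->|q0] := eqVneq q 0; first by left.
  by have [vq|vq] := leP 0 (v q); [left; right|right].
  have m0 : 0 <= m.
    rewrite leNgt; apply/negP => mlt.
    have : 0 <= m; last lia.
    apply: (@no_left_branch q) => //; first lia.
    by apply: vge_le qO; lia.
  have [||||_ E2] := @V_same (g * Dm m) (g * T q m) (mk 1 q 0 1) 1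
      (unitm_mulDm _ ug) (oner_neq0 _).
  - by apply/M2OP.
  - by rewrite mkdet mulr1 mulr0 subr0 oner_neq0.
  - by rewrite mkdet mulr1 mulr0 subr0 v1.
  - by rewrite scale1r -mulrA; congr (_ * _); rewrite /T /Dm mkM; congr mk; ring.
  exists m; split; last exact: sameset_trans (sameset_sym E2) (sameset_trans E1 VR).
  by rewrite m0 /=; apply: (@maxn g); split=> // a /HT /E2.
pose k' := - v q; pose u := q * pi ^ k'.
have u0 : u != 0 by rewrite mulf_neq0 ?piz0.
have vu : v u = 0 by rewrite vM ?piz0 // vXz /k' subrr.
have qE : q = u * pi ^ (- k') by rewrite /u -invr_expz mulfK ?piz0.
have [j0|j0] := leP (m + k') 0.
  have : 0 <= m; last by rewrite /k' in j0; lia.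
  apply: (@no_left_branch q) => //; first by rewrite /k' in j0; lia.
  by apply: vge_le (vge_v q); rewrite /k' in j0; lia.
rewrite qE in HT; have k0' : 0 < k' by rewrite /k'; lia.
have [jn|jn] := leP n (m + k').
  by case: (no_right_branch u0 vu k0' jn HT).
by case: (no_inner_branch u0 vu k0' j0 jn HT).
Qed.

End Maximal.

Lemma thin_is_line H : is_full_order v H ->
  (forall g, unitm g -> ~ subsetM H (thicken (V g))) -> is_line v pi (branch v H).
Proof.
move=> fH Hthin; have [g [n [n0 sg maxn]]] := segment_max fH.
have [ug _ _] := sg.
exists (fun i => 0 <= i <= n), (fun i => V (g * Dm i)); split.
- by exists 0; rewrite lexx.
- by move=> a b c; lia.
- split=> [i /andP [i0 il]|R HR].
    split; first by apply: V_maximal; apply: unitm_mulDm.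
    exact: segment_sub sg i0 il.
  exact: (branch_on_segment fH Hthin n0 sg maxn HR).
- by move=> i j _ _; apply: VDm_inj.
- by move=> i j _ _; apply: VDm_adj.
Qed.

Lemma Bass_thin H : Bass v H ->
  forall g, unitm g -> ~ subsetM H (thicken (V g)).
Proof.
move=> [_ B] g ug HT; apply: (thick_not_Gorenstein ug); apply: B HT.
exact: thicken_order (proj1 (V_full ug)).
Qed.

Lemma Bass_iff_line H : is_full_order v H ->
  Bass v H <-> is_line v pi (branch v H).
Proof.
move=> fH; split; last exact: line_Bass.
by move=> /Bass_thin; apply: thin_is_line.
Qed.

End Valued.

Theorem theorem1p2 (K : fieldType) (v : K -> int) (hK : is_local_field v)
    (pi : K) (hpi0 : pi != 0) (hpi : v pi = 1)
    (H : mxset K) (hH : is_full_order v H) :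
  Bass v H <-> is_line v pi (branch v H).
Proof. exact: (Bass_iff_line hK hpi0 hpi hH). Qed.
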